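(* For each integer $d$ with $d\ge 21$ or $d\in\{17,18\}$ we have $n_2(6,d,2)=g_2(6,d)$. Moreover, $n_2(6,1,2)=n_2(6,2,2)=9$, $n_2(6,3,2)=n_2(6,4,2)=12$, $n_2(6,5,2)=n_2(6,6,2)=15$, $n_2(6,7,2)=n_2(6,8,2)=18$, $n_2(6,9,2)=22$, $n_2(6,10,2)=23$, $n_2(6,11,2)=25$, $n_2(6,12,2)=26$, $n_2(6,13,2)=30$, $n_2(6,14,2)=31$, $n_2(6,15,2)=n_2(6,16,2)=33$, $n_2(6,19,2)=41$, and $n_2(6,20,2)=42$.
   Context: An $[n,k,d]_q$-code is a $k$-dimensional subspace of $\mathbb{F}_q^n$ with minimum Hamming distance at least $d$. A linear code $C\subseteq\mathbb{F}_q^n$ has locality $r$ if for every coordinate $i$ there is a set $S_i\subseteq\{1,\dots,n\}\setminus\{i\}$ with $|S_i|\le r$ such that any two codewords agreeing on all coordinates in $S_i$ also agree in coordinate $i$. $n_q(k,d,r)$ denotes the minimum length $n$ of an $[n,k,d]_q$-code with locality $r$. $g_q(k,d)=\sum_{i=0}^{k-1}\lceil d/q^i\rceil$. *)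

(* Defs.v *)
From HB Require Import structures.
From mathcomp Require Import all_boot all_order all_algebra.

Set Implicit Arguments.
Unset Strict Implicit.
Unset Printing Implicit Defensive.

Definition hamming_dist (F : finFieldType) (n : nat) (u v : 'rV[F]_n) : nat :=
  #|[set i : 'I_n | u ord0 i != v ord0 i]|.

Definition is_code (F : finFieldType) (n k d : nat) (C : {vspace 'rV[F]_n}) :
    Prop :=
  \dim C = k /\
  (forall u v : 'rV[F]_n, u \in C -> v \in C -> u <> v ->
     d <= hamming_dist u v).

Definition has_locality (F : finFieldType) (n r : nat)
    (C : {vspace 'rV[F]_n}) : Prop :=
  forall i : 'I_n, exists S : {set 'I_n},
    [/\ i \notin S, #|S| <= r &
        forall u v : 'rV[F]_n, u \in C -> v \in C ->
          (forall j, j \in S -> u ord0 j = v ord0 j) ->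
          u ord0 i = v ord0 i].

Definition lrc_exists (F : finFieldType) (n k d r : nat) : Prop :=
  exists C : {vspace 'rV[F]_n}, is_code k d C /\ has_locality r C.

(* [is_min_length F k d r n] reads n_q(k,d,r) = n, where q = #|F|. It is a
   relation because the set of admissible lengths may be empty (e.g. r = 0). *)
Definition is_min_length (F : finFieldType) (k d r n : nat) : Prop :=
  lrc_exists F n k d r /\ (forall m : nat, lrc_exists F m k d r -> n <= m).

Definition ceil_div (a b : nat) : nat := (a + b.-1) %/ b.

Lemma ceil_divP (a b m : nat) : 0 < b -> (ceil_div a b <= m) = (a <= m * b).
Proof.
move=> b_gt0; rewrite /ceil_div -ltnS ltn_divLR // mulSn addnC.
by rewrite -{2}(prednK b_gt0) addSn ltnS leq_add2l.
Qed.

Definition griesmer (q k d : nat) : nat := \sum_(0 <= i < k) ceil_div d (q ^ i).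

(* Main.v *)
Require Import Defs.
From HB Require Import structures.
From mathcomp Require Import all_boot all_order all_algebra all_field.
From mathcomp Require Import zify.

(* Read a generator matrix as a multiset of points of PG(5,2). Locality 2 says
   that every coordinate is zero, is repeated, or lies on a line all of whose
   points occur.

   Lower bounds. Griesmer's bound and residual codes (restriction to the zeros of
   a codeword) exclude most weights, and the first two power moments then
   determine the weight distribution; the second moment also counts the pairs of
   equal coordinates. Applied to the subcode vanishing at a coordinate x, the
   moments count the lines through x. For d = 13, 14 the resulting numbers lam(x)
   of lines satisfy a linear congruence for each x, while projecting from each
   line determines the sum of lam(x)^2; this is contradictory unless the all-one
   word is in the code, and then there is no line at all. For d = 15 all lines
   pass through one point and pair up the remaining 31 coordinates. For d = 5 the
   lines partition the 14 coordinates, for d = 7 each line of the parity extension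
   through the parity coordinate leaves two coordinates without a line, and for
   d = 1, 3 one counts the ones in a basis of the space spanned by the
   local parity checks.

   Upper bounds. For d >= 21 remove suitable subspaces from one or two copies of
   PG(5,2); adding a full copy of PG(5,2) increases d by 32 and preserves
   locality. The small cases are explicit point sets. *)

Set Implicit Arguments.
Unset Strict Implicit.
Unset Printing Implicit Defensive.

(** * Binary linear codes as families of sets *)

Section SetCode.

Variable I : finType.
Implicit Types (i j l x y z : I) (u v c : {set I}) (T : {set I}).
Implicit Types (C : {set {set I}}) (f g : {set I} -> bool).

(** Words are represented by their supports, and the set [T] of live coordinates is a separate
    argument: shortening shrinks the family, deleting a coordinate shrinks [T], and iterated
    quotients stay in one type. The hard point is length 30 with distance 14. The first-order
    Reed-Muller code of length 32, punctured twice, has these parameters, so no bound that ignores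
    locality can settle it. What does hold without locality is that an even code of this kind
    contains the all-one word. Three coordinates adding up to zero contradict such a word, so
    locality would force every coordinate to be repeated, while the second moment has room for a
    single repeated pair. Excluding even codes without the all-one word is tight: when all columns
    differ, the sums of lam(x) and of lam(x)^2 are exactly those of the constant value 10, so the
    inequality (lam(x) - 10)^2 >= 0 gives nothing, and only the residue of lam(x) modulo 3, which
    forbids the value 10, yields the contradiction. *)

Definition symd u v : {set I} := [set i | (i \in u) (+) (i \in v)].

Lemma in_symd i u v : (i \in symd u v) = (i \in u) (+) (i \in v).
Proof. by rewrite inE. Qed.

Lemma symdd u : symd u u = set0.
Proof. by apply/setP=> i; rewrite !inE addbb. Qed.

Lemma symdK v : involutive (symd^~ v).
Proof. by move=> u; apply/setP=> i; rewrite !inE -addbA addbb addbF. Qed.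

Lemma symd_eq0 u v : (symd u v == set0) = (u == v).
Proof.
apply/eqP/eqP=> [e | ->]; last exact: symdd.
by rewrite -(symdK v u) /= e; apply/setP=> i; rewrite !inE.
Qed.

Definition linear_code C :=
  set0 \in C /\ {in C &, forall u v, symd u v \in C}.

Definition wt T u := #|u :&: T|.

(** For [d > 0] a nonzero word cannot vanish on [T], so [#|C| = 2 ^ k] still says that the code read
    on [T] has dimension [k]. *)
Definition min_dist C T d := forall u, u \in C -> u != set0 -> d <= wt T u.

Definition functional f := forall u v, f (symd u v) = f u (+) f v.

Definition ker C f := [set u in C | ~~ f u].

Lemma functional_coord i : functional (fun u => i \in u).
Proof. by move=> u v; rewrite inE. Qed.

Lemma functional_coord2 i j : functional (fun u => (i \in u) (+) (j \in u)).
Proof. by move=> u v; rewrite !inE addbACA. Qed.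

Lemma functional0 f : functional f -> f set0 = false.
Proof. by move=> ff; rewrite -(symdd set0) ff addbb. Qed.

Lemma wtE T u : wt T u = \sum_(i in T) (i \in u).
Proof.
rewrite /wt -sum1_card big_mkcond [RHS]big_mkcond /=; apply: eq_bigr => i _.
by rewrite inE andbC; case: (i \in T); case: (i \in u).
Qed.

Lemma wt0 T : wt T set0 = 0.
Proof. by rewrite /wt set0I cards0. Qed.

Lemma wt_le T u : wt T u <= #|T|.
Proof. by rewrite subset_leq_card // subsetIr. Qed.

Lemma wt_symd T u v :
  wt T (symd u v) + 2 * wt T (u :&: v) = wt T u + wt T v.
Proof.
rewrite !wtE big_distrr -!big_split; apply: eq_bigr => i _ /=.
by rewrite !inE; case: (i \in u); case: (i \in v).
Qed.

(** The words [u] and [symd u c] agree off [c] and are complementary on [c]. Bounding both weights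
    from below is what gives the residual code its distance. *)
Lemma wt_residual T u c :
  2 * wt (T :\: c) u + wt T c = wt T u + wt T (symd u c).
Proof.
have -> : wt (T :\: c) u = \sum_(i in T) ((i \in u) && (i \notin c)).
  rewrite wtE [LHS]big_mkcond [RHS]big_mkcond /=; apply: eq_bigr => i _.
  by rewrite inE; case: (i \in T); case: (i \in c); case: (i \in u).
rewrite !wtE big_distrr -!big_split; apply: eq_bigr => i _ /=.
by rewrite !inE; case: (i \in u); case: (i \in c).
Qed.

Lemma functional_odd T : functional (fun u => odd (wt T u)).
Proof.
move=> u v; have /(congr1 odd) := wt_symd T u v.
by rewrite oddD oddM addbF oddD.
Qed.

Section Linear.

Variable C : {set {set I}}.
Hypothesis linC : linear_code C.

Lemma ker_linear f : functional f -> linear_code (ker C f).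
Proof.
case: linC => C0 CD ff; split=> [|u v]; first by rewrite inE C0 functional0.
by rewrite !inE => /andP[uC /negbTE uf] /andP[vC /negbTE vf]; rewrite CD // ff uf vf.
Qed.

Lemma card_half f : functional f -> (exists2 u, u \in C & f u) ->
  #|[set u in C | f u]| = #|ker C f|.
Proof.
case: linC => C0 CD ff [c cC fc].
rewrite -(card_imset _ (inv_inj (symdK c))); apply: eq_card => v.
apply/imsetP/idP=> [[u + ->]|]; rewrite !inE.
  by case/andP=> uC fu; rewrite CD // ff fu fc.
case/andP=> vC fv; exists (symd v c); last by rewrite symdK.
by rewrite inE CD // ff (negbTE fv).
Qed.

Lemma card_split f : #|C| = #|[set u in C | f u]| + #|ker C f|.
Proof.
rewrite -(cardsID [set u | f u] C); congr (_ + _); apply: eq_card => u.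
  by rewrite !inE.
by rewrite !inE andbC.
Qed.

Lemma card_ker f : functional f -> (exists2 u, u \in C & f u) ->
  #|C| = 2 * #|ker C f|.
Proof. by move=> ff fC; rewrite (card_split f) card_half // mul2n addnn. Qed.

Lemma leq_card_ker f : functional f -> #|C| <= 2 * #|ker C f|.
Proof.
move=> ff; case: (pickP [pred u in C | f u]) => [u /andP[uC fu]|f0].
  by rewrite (card_ker ff) //; exists u.
rewrite (card_split f) (@eq_card0 _ [set u in C | f u]) ?leq_pmull // => u.
by rewrite inE; exact: f0.
Qed.

(** Duality in codimension one: restriction to [ker C f] kills only the functionals 0 and [f]. Every
    statement about columns of a shortened code is pulled back to [C] in this way. *)
Lemma vanish_ker f g : functional f -> functional g ->
    {in ker C f, forall u, ~~ g u} ->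
  {in C, forall u, ~~ g u} \/ {in C, g =1 f}.
Proof.
case: linC => C0 CD ff gf gk.
case: (pickP [pred u in C | g u]) => [c /andP[/= cC gc]|g0]; last first.
  by left=> u uC; have /= := g0 u; rewrite uC /= => ->.
have fc : f c by apply: contraLR gc => fc; apply: gk; rewrite inE cC.
right=> u uC; case fu: (f u); last first.
  by apply/negbTE/gk; rewrite inE uC fu.
have := gk (symd u c); rewrite inE CD // ff fu fc => /(_ isT).
by rewrite gf gc addbT negbK.
Qed.

Lemma ker_min_dist f T d : min_dist C T d -> min_dist (ker C f) T d.
Proof. by move=> md u; rewrite inE => /andP[uC _]; exact: md. Qed.

End Linear.

End SetCode.

(** * Columns and power moments *)

Section Columns.

Variable I : finType.
Implicit Types (i j l x y z : I) (u v c : {set I}) (T : {set I}).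
Implicit Types (C : {set {set I}}) (f g : {set I} -> bool).

Definition zerocol C i := [forall u in C, i \notin u].

Definition eqc C i j := [forall u in C, (i \in u) == (j \in u)].

Definition tri C x i j := [forall u in C, (x \in u) == (i \in u) (+) (j \in u)].

(** Geometrically this is the projection from the point [x]: columns of the shortened code are
    columns of [C] modulo that of [x]. *)
Definition short C x := ker C (fun u => x \in u).

Definition mult C T x := \sum_(j in T) eqc C x j.

Definition eqpairs C T := \sum_(i in T) mult C T i.

(** The pairs are ordered, so a line through [x] with simple points is counted twice. Likewise
    [eqpairs] counts ordered pairs, the diagonal included; this is the form in which the second
    moment produces them. *)
Definition sumpairs C T x := \sum_(i in T) \sum_(j in T) tri C x i j.

Definition nwt C T w := #|[set u in C | wt T u == w]|.

Lemma zerocolP C i : reflect {in C, forall u, i \notin u} (zerocol C i).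
Proof. exact: forall_inP. Qed.

Lemma eqcP C i j : reflect {in C, forall u, (i \in u) = (j \in u)} (eqc C i j).
Proof. by apply: (iffP forall_inP) => h u /h /eqP. Qed.

Lemma triP C x i j :
  reflect {in C, forall u, (x \in u) = (i \in u) (+) (j \in u)} (tri C x i j).
Proof. by apply: (iffP forall_inP) => h u /h /eqP. Qed.

Lemma eqc_refl C i : eqc C i i.
Proof. by apply/eqcP. Qed.

Lemma eqc_sym C i j : eqc C i j = eqc C j i.
Proof. by apply/eqcP/eqcP=> h u /h. Qed.

Lemma eqc_trans C j i l : eqc C i j -> eqc C j l -> eqc C i l.
Proof. by move=> /eqcP ij /eqcP jl; apply/eqcP=> u uC; rewrite ij ?jl. Qed.

Lemma tri_swap C x i j : tri C x i j = tri C x j i.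
Proof. by apply/triP/triP=> h u /h; rewrite addbC. Qed.

Lemma tri_rot C x i j : tri C x i j = tri C i x j.
Proof.
by apply/triP/triP=> h u /h; case: (x \in u); case: (i \in u); case: (j \in u).
Qed.

Lemma tri_xx C x j : tri C x x j = zerocol C j.
Proof.
apply/triP/zerocolP=> h u /h; first by case: (x \in u); case: (j \in u).
by move=> /negbTE->; rewrite addbF.
Qed.

Lemma tri_diag C x i : tri C x i i = zerocol C x.
Proof.
by apply/triP/zerocolP=> h u /h; rewrite addbb; [move->|move/negbTE].
Qed.

Lemma tri_eqc C x i j l : tri C x i j -> eqc C j l = tri C x i l.
Proof.
move=> /triP t; apply/eqcP/triP=> h u uC; first by rewrite -h ?t.
by move: (h u uC); rewrite t //; case: (i \in u); case: (j \in u); case: (l \in u).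
Qed.

Lemma eqc_zerocol C x y : eqc C x y -> zerocol C x = zerocol C y.
Proof. by move=> /eqcP e; apply/zerocolP/zerocolP=> h u uC; [rewrite -e|rewrite e]; auto. Qed.

Lemma mult_gt0 C T x : x \in T -> 0 < mult C T x.
Proof. by move=> xT; rewrite /mult (bigD1 x) //= eqc_refl. Qed.

Lemma mult_gt1P C T x : x \in T ->
  reflect (exists y, [/\ y \in T, y != x & eqc C x y]) (1 < mult C T x).
Proof.
move=> xT; rewrite /mult (bigD1 x) //= eqc_refl ltnS lt0n sum_nat_eq0 negb_forall.
apply: (iffP existsP) => -[y].
  rewrite negb_imply => /andP[/andP[yT yx]]; rewrite eqb0 negbK => e.
  by exists y.
by case=> yT yx e; exists y; rewrite yT yx e.
Qed.

Lemma eqpairsD1 C T x : x \in T ->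
  eqpairs C T + 1 = eqpairs C (T :\ x) + 2 * mult C T x.
Proof.
move=> xT; rewrite /eqpairs (big_setD1 x) //=.
have -> : \sum_(i in T :\ x) mult C T i
    = \sum_(i in T :\ x) mult C (T :\ x) i + \sum_(i in T :\ x) eqc C x i.
  rewrite -big_split; apply: eq_bigr => i _ /=.
  by rewrite /mult (big_setD1 x) //= addnC eqc_sym.
have -> : mult C T x = 1 + \sum_(i in T :\ x) eqc C x i.
  by rewrite /mult (big_setD1 x) //= eqc_refl.
lia.
Qed.

Lemma leq_eqpairs C T m : {in T, forall i, mult C T i <= m} ->
  eqpairs C T <= #|T| * m.
Proof. by move=> h; rewrite -sum_nat_const; apply: leq_sum. Qed.

Lemma geq_eqpairs C T : #|T| <= eqpairs C T.
Proof. by rewrite -sum1_card; apply: leq_sum => i; exact: mult_gt0. Qed.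

Lemma sumpairsD1 C T x : {in T, forall i, ~~ zerocol C i} ->
  sumpairs C (T :\ x) x = sumpairs C T x.
Proof.
move=> nz; rewrite /sumpairs; case xT: (x \in T); last first.
  suff -> : T :\ x = T by [].
  by apply/setP=> i; rewrite !inE; case: eqP => // ->.
have xx0 : \sum_(j in T) tri C x x j = 0.
  by apply: big1 => j jT; rewrite tri_xx (negbTE (nz _ _)).
rewrite [RHS](big_setD1 x) //= xx0 add0n; apply: eq_bigr => i; rewrite !inE => /andP[_ iT].
by rewrite [RHS](big_setD1 x) //= tri_swap tri_xx (negbTE (nz _ _)).
Qed.

Section Linear.

Variable C : {set {set I}}.
Hypothesis linC : linear_code C.

Lemma short_linear x : linear_code (short C x).
Proof. exact: ker_linear (functional_coord x). Qed.

Lemma card_short x : ~~ zerocol C x -> #|C| = 2 * #|short C x|.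
Proof.
rewrite negb_forall => /existsP[u]; rewrite negb_imply negbK => /andP[uC xu].
by apply: card_ker; [|exact: functional_coord|exists u].
Qed.

Lemma leq_card_short x : #|C| <= 2 * #|short C x|.
Proof. exact: leq_card_ker (functional_coord x). Qed.

Lemma zerocol_short x i :
  zerocol (short C x) i = zerocol C i || eqc C i x.
Proof.
apply/zerocolP/orP=> [h|].
  have [h'|h'] := vanish_ker linC (functional_coord x) (functional_coord i) h.
    by left; apply/zerocolP.
  by right; apply/eqcP.
case=> [/zerocolP|/eqcP] h u; rewrite inE => /andP[uC]; first by move=> _; apply: h.
by rewrite h.
Qed.

(** Modulo [x], two columns agree when they are equal or differ by [x]. Both at once would make [x]
    zero, so the disjunction is a sum in [nat] and can be added over all pairs. *)
Lemma eqc_short x i j : ~~ zerocol C x ->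
  eqc (short C x) i j = eqc C i j + tri C x i j :> nat.
Proof.
move=> nz; have -> : eqc (short C x) i j = eqc C i j || tri C x i j.
  apply/eqcP/orP=> [h|].
    have [u|h'|h'] := @vanish_ker _ C linC _ _ (functional_coord x) (functional_coord2 i j).
    - by move/h=> ->; rewrite addbb.
    - by left; apply/eqcP=> u /h'; case: (i \in u); case: (j \in u).
    by right; apply/triP=> u /h'.
  case=> [/eqcP|/triP] h u; rewrite inE => /andP[uC]; first by rewrite h.
  by rewrite h //; case: (i \in u); case: (j \in u).
case e: (eqc C i j); case t: (tri C x i j) => //.
case/negP: nz; apply/zerocolP=> u uC.
by rewrite (triP _ _ _ _ t) // (eqcP _ _ _ e) // addbb.
Qed.

(** With [x = y + z] as columns, a sum congruent to [y] modulo [x] is either [y] or [x + y = z]. *)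
Lemma tri_short x y z i j : ~~ zerocol C x -> tri C x y z ->
  tri (short C x) y i j = tri C y i j + tri C z i j :> nat.
Proof.
move=> nz /triP t.
have f3 : functional (fun u => (y \in u) (+) ((i \in u) (+) (j \in u))).
  by move=> u v; rewrite !inE; do !case: (_ \in _).
have -> : tri (short C x) y i j = tri C y i j || tri C z i j.
  apply/triP/orP=> [h|].
    have [u|h'|h'] := @vanish_ker _ C linC _ _ (functional_coord x) f3.
    - by move/h=> ->; rewrite addbb.
    - by left; apply/triP=> u /h'; do !case: (_ \in _).
    right; apply/triP=> u uC; move: (h' u uC) (t u uC).
    by do !case: (_ \in _).
  case=> /triP h u; rewrite inE => /andP[uC xu]; first by rewrite h.
  by rewrite -h //; move: xu (t u uC); do !case: (_ \in _).
case y1: (tri C y i j); case z1: (tri C z i j) => //.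
case/negP: nz; apply/zerocolP=> u uC; rewrite t //.
by rewrite (triP _ _ _ _ y1) // (triP _ _ _ _ z1) // addbb.
Qed.

Lemma sum_functional f : functional f ->
  2 * \sum_(u in C) f u = #|C| * ~~ [forall u in C, ~~ f u].
Proof.
move=> ff; have -> : \sum_(u in C) f u = #|[set u in C | f u]|.
  rewrite -sum1_card big_mkcond [RHS]big_mkcond /=; apply: eq_bigr => u _.
  by rewrite inE; case: (u \in C); case: (f u).
have [/forall_inP f0|/forall_inPn[u uC /negPn fu]] := boolP [forall u in C, ~~ f u].
  rewrite muln0 (@eq_card0 _ [set u in C | f u]) // => u; rewrite inE.
  by case uC: (u \in C) => //; rewrite (negbTE (f0 u uC)).
by rewrite muln1 card_half //; [rewrite -card_ker //|]; exists u.
Qed.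

Lemma sum_wt T : {in T, forall i, ~~ zerocol C i} ->
  2 * \sum_(u in C) wt T u = #|C| * #|T|.
Proof.
move=> nz; rewrite (eq_bigr _ (fun u _ => wtE T u)) exchange_big big_distrr /=.
rewrite -sum1_card big_distrr /=; apply: eq_bigr => i iT.
by rewrite (sum_functional (functional_coord i)) -/(zerocol C i) (nz i iT).
Qed.

(* The pointwise identity [2ab + (a xor b) = a + b] reduces the second moment
   to counting words on which a functional is nonzero. *)
Lemma sum_wt_sq T : {in T, forall i, ~~ zerocol C i} ->
  4 * \sum_(u in C) wt T u * wt T u = #|C| * (#|T| * #|T| + eqpairs C T).
Proof.
move=> nz.
have one i : i \in T -> 2 * \sum_(u in C) (i \in u) = #|C|.
  by move=> /nz zi; rewrite (sum_functional (functional_coord i)) -/(zerocol C i) zi muln1.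
have two i j : i \in T -> j \in T ->
    4 * \sum_(u in C) (i \in u) * (j \in u) = #|C| * (1 + eqc C i j).
  move=> /one iT /one jT.
  have := sum_functional (functional_coord2 i j).
  have -> : [forall u in C, ~~ ((i \in u) (+) (j \in u))] = eqc C i j.
    by apply: eq_forallb => u; case: (i \in u); case: (j \in u).
  have : 2 * (\sum_(u in C) (i \in u) * (j \in u))
      + \sum_(u in C) ((i \in u) (+) (j \in u))
      = \sum_(u in C) (i \in u) + \sum_(u in C) (j \in u).
    rewrite big_distrr -!big_split; apply: eq_bigr => u _ /=.
    by case: (i \in u); case: (j \in u).
  move: iT jT; move: (\sum_(u in C) (i \in u)) (\sum_(u in C) (j \in u)) => a b.
  move: (\sum_(u in C) _ * _) (\sum_(u in C) (_ (+) _)) => e g.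
  by case: (eqc C i j) => /=; lia.
have -> : \sum_(u in C) wt T u * wt T u
    = \sum_(i in T) \sum_(j in T) \sum_(u in C) (i \in u) * (j \in u).
  transitivity (\sum_(u in C) \sum_(i in T) \sum_(j in T) (i \in u) * (j \in u)).
    apply: eq_bigr => u _; rewrite wtE big_distrl; apply: eq_bigr => i _ /=.
    by rewrite big_distrr.
  rewrite exchange_big; apply: eq_bigr => i _ /=.
  by rewrite exchange_big.
rewrite big_distrr /=.
transitivity (\sum_(i in T) #|C| * (#|T| + mult C T i)).
  apply: eq_bigr => i iT; rewrite /mult -[#|T|]sum1_card -big_split !big_distrr /=.
  by apply: eq_bigr => j jT; rewrite two.
by rewrite -big_distrr /= big_split /= sum_nat_const.
Qed.

Lemma sum_by_weight (F : nat -> nat) T (ws : seq nat) : uniq ws ->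
    {in C, forall u, wt T u \in ws} ->
  \sum_(u in C) F (wt T u) = \sum_(w <- ws) F w * nwt C T w.
Proof.
move=> uws inws.
transitivity (\sum_(u in C) \sum_(w <- ws) F w * (wt T u == w)).
  apply: eq_bigr => u uC; rewrite (bigD1_seq (wt T u)) ?inws //= eqxx muln1.
  by rewrite big1 ?addn0 // => w; rewrite eq_sym => /negbTE ->; rewrite muln0.
rewrite exchange_big; apply: eq_bigr => w _ /=; rewrite -big_distrr /=; congr (_ * _).
rewrite /nwt -sum1_card big_mkcond [RHS]big_mkcond; apply: eq_bigr => u _ /=.
by rewrite inE; case: (u \in C); case: (_ == _).
Qed.

Lemma nwt0 T d : 0 < d -> min_dist C T d -> nwt C T 0 = 1.
Proof.
move=> d0 md; rewrite /nwt -(cards1 (set0 : {set I})); apply: eq_card => u.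
rewrite !inE; apply/andP/eqP=> [[uC /eqP u0]|->]; last by rewrite wt0 linC.1.
by apply/eqP/negPn/negP=> /(md u uC); rewrite u0; lia.
Qed.

Lemma power_moments T d (ws : seq nat) : 0 < d -> min_dist C T d ->
    {in T, forall i, ~~ zerocol C i} -> uniq (0 :: ws) ->
    {in C, forall u, wt T u \in 0 :: ws} ->
  [/\ 1 + \sum_(w <- ws) nwt C T w = #|C|,
      2 * \sum_(w <- ws) w * nwt C T w = #|C| * #|T| &
      4 * \sum_(w <- ws) w * w * nwt C T w = #|C| * (#|T| * #|T| + eqpairs C T)].
Proof.
move=> d0 md nz uws inws.
have h F := sum_by_weight F uws inws; split.
- have := h (fun=> 1); rewrite sum1_card => ->.
  by rewrite big_cons (nwt0 d0 md); congr (_ + _); apply: eq_bigr => w _; rewrite mul1n.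
- by rewrite -sum_wt // (h id) big_cons.
by rewrite -sum_wt_sq // (h (fun w => w * w)) big_cons.
Qed.

Lemma mult_short x T i : ~~ zerocol C x ->
  mult (short C x) T i = mult C T i + \sum_(j in T) tri C x i j.
Proof.
by move=> nz; rewrite /mult -big_split; apply: eq_bigr => j _; exact: eqc_short.
Qed.

Lemma eqpairs_short x T : ~~ zerocol C x ->
  eqpairs (short C x) T = eqpairs C T + sumpairs C T x.
Proof.
by move=> nz; rewrite /eqpairs -big_split; apply: eq_bigr => i _; exact: mult_short.
Qed.

End Linear.

End Columns.

(** * Griesmer bound, residual codes and parity extension *)

Ltac clia := unfold reverse_coercion in *; lia.

(** Rounding up after each halving agrees with rounding up once at the end, so the Griesmer sum can
    be unfolded along successive residual codes. *)
Fixpoint gr k d := if k is k'.+1 then d + gr k' (uphalf d) else 0.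

Lemma griesmerE k d : griesmer 2 k d = gr k d.
Proof.
elim: k d => [|k IHk] d; first by rewrite /griesmer big_geq.
rewrite /griesmer big_nat_recl // {1}/ceil_div addn0 divn1 /= -IHk.
congr (_ + _); apply: eq_bigr => i _.
have e m : (ceil_div d (2 ^ i.+1) <= m) = (ceil_div (uphalf d) (2 ^ i) <= m).
  rewrite !ceil_divP ?expn_gt0 // expnS mulnCA.
  by move: (m * _) => a; lia.
by apply/eqP; rewrite eqn_leq e leqnn -e leqnn.
Qed.

Section Bounds.

Variable I : finType.
Implicit Types (i j l x y z : I) (u v c : {set I}) (T D : {set I}).
Implicit Types (C : {set {set I}}).

Lemma exists_nonzero C : 1 < #|C| -> exists2 c, c \in C & c != set0.
Proof.
move=> C1; have /card_gt0P[c] : 0 < #|C :\ set0|.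
  by rewrite (cardsD1 set0) in C1; case: (_ \in _) C1 => /=; clia.
by rewrite !inE => /andP[c0 cC]; exists c.
Qed.

(** Take the residual at a word [c] of least weight, realised as the subcode vanishing at one
    coordinate of [c] and read off [c]. Minimality cancels [wt T c] in [wt_residual], so at least
    half of [d] survives. *)
Lemma griesmer_bound k C T d : linear_code C -> 2 ^ k <= #|C| ->
  min_dist C T d -> gr k d <= #|T|.
Proof.
elim: k C T d => // k IHk C T d linC cardC md /=.
have [|c0 c0C c0N] := @exists_nonzero C.
  by apply: leq_trans cardC; rewrite expnS leq_pmulr ?expn_gt0.
have [|c /andP[cC cN] cmin] :=
  @arg_minnP _ c0 (fun c => (c \in C) && (c != set0)) (wt T); first by rewrite c0C.
have [i ic] := set0Pn _ cN.
have linS := short_linear linC i.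
have cardS : 2 ^ k <= #|short C i|.
  have := leq_card_short linC i.
  by rewrite expnS in cardC; clia.
have mdS : min_dist (short C i) (T :\: c) (uphalf d).
  move=> u; rewrite inE => /andP[uC iu] uN.
  have ucC : symd u c \in C by apply: linC.2.
  have ucN : symd u c != set0.
    by rewrite symd_eq0; apply: contraNneq iu => ->.
  have := wt_residual T u c.
  have := cmin (symd u c); rewrite ucC ucN => /(_ isT).
  by have := md u uC uN; clia.
have := IHk _ _ _ linS cardS mdS; have := md c cC cN.
by have := cardsID c T; rewrite setIC -/(wt T c); clia.
Qed.

Lemma wt_vanish T D u : {in D, forall i, i \notin u} -> wt (T :\: D) u = wt T u.
Proof.
move=> vD; apply: eq_card => i; rewrite !inE.
by case iu: (i \in u) => //=; case iD: (i \in D) => //; have := vD i iD; rewrite iu.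
Qed.

Lemma min_dist_vanish C T D d : {in C & D, forall u i, i \notin u} ->
  min_dist C T d -> min_dist C (T :\: D) d.
Proof. by move=> v md u uC uN; rewrite wt_vanish ?md // => i; exact: v. Qed.

Lemma short_vanish C T x y d : eqc C x y ->
  min_dist C T d -> min_dist (short C x) (T :\: [set x; y]) d.
Proof.
move=> /eqcP e md; apply: min_dist_vanish; last exact: ker_min_dist.
move=> u i; rewrite inE => /andP[uC xu]; rewrite !inE => /orP[] /eqP -> //.
by rewrite -e.
Qed.

(** Here [c] need not have least weight: both [u] and [symd u c] are only known to weigh at least
    [d], whence the loss of half the weight of [c]. *)
Lemma residual_code k C T d c : linear_code C -> #|C| = 2 ^ k.+1 ->
    min_dist C T d -> c \in C -> c != set0 ->
  exists C', [/\ linear_code C', #|C'| = 2 ^ k & min_dist C' (T :\: c) (d - (wt T c)./2)].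
Proof.
move=> linC cardC md cC cN; have [i ic] := set0Pn _ cN.
have nz : ~~ zerocol C i by apply/forall_inPn; exists c; rewrite ?negbK.
exists (short C i); split; first exact: short_linear.
  by have := card_short linC nz; rewrite cardC expnS; clia.
move=> u; rewrite inE => /andP[uC iu] uN.
have ucN : symd u c != set0 by rewrite symd_eq0; apply: contraNneq iu => ->.
have := md _ (linC.2 _ _ uC cC) ucN; have := md u uC uN; have := wt_residual T u c.
clia.
Qed.

(** The words overlap in at least [wt T u + wt T v - #|T|] places, and each of these is lost twice
    in their sum. *)
Lemma weight_sum_bound C T d u v : linear_code C -> min_dist C T d ->
  u \in C -> v \in C -> u != v -> d + wt T u + wt T v <= 2 * #|T|.
Proof.
move=> linC md uC vC uv.
have := md _ (linC.2 _ _ uC vC); rewrite symd_eq0 => /(_ uv).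
have := wt_symd T u v.
have : wt T u + wt T v <= wt T (u :&: v) + #|T|.
  rewrite !wtE -sum1_card -!big_split; apply: leq_sum => i _ /=.
  by rewrite inE; case: (i \in u); case: (i \in v).
clia.
Qed.

Lemma nwt_le1 C T d w : linear_code C -> min_dist C T d ->
  2 * #|T| < d + w + w -> nwt C T w <= 1.
Proof.
move=> linC md h; rewrite leqNgt; apply/negP=> /card_gt1P[u [v []]].
rewrite !inE => /andP[uC /eqP uw] /andP[vC /eqP vw] uv.
by have := weight_sum_bound linC md uC vC uv; clia.
Qed.

Lemma eqpairs1 C T : {in T, forall i, mult C T i <= 1} -> eqpairs C T = #|T|.
Proof.
move=> h; apply/eqP; rewrite eqn_leq geq_eqpairs andbT.
by have := leq_eqpairs h; rewrite muln1.
Qed.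

Lemma weights_in C T (ws : seq nat) :
    {in C, forall u, u != set0 -> wt T u \in ws} ->
  {in C, forall u, wt T u \in 0 :: ws}.
Proof.
move=> h u uC; rewrite inE; case: (eqVneq u set0) => [->|uN]; first by rewrite wt0.
by rewrite h ?orbT.
Qed.

End Bounds.

Section Extension.

Variables (I : finType) (T : {set I}).

Definition ext (u : {set I}) : {set option I} :=
  [set x | if x is Some i then i \in u else odd (wt T u)].

Definition ext_code (C : {set {set I}}) := ext @: C.

Definition ext_coords : {set option I} := None |: Some @: T.

Lemma some_ext i u : (Some i \in ext u) = (i \in u).
Proof. by rewrite inE. Qed.

Lemma ext_inj : injective ext.
Proof. by move=> u v e; apply/setP=> i; rewrite -!some_ext e. Qed.

Lemma card_ext_code C : #|ext_code C| = #|C|.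
Proof. exact: card_imset ext_inj. Qed.

Lemma card_ext_coords : #|ext_coords| = #|T|.+1.
Proof.
rewrite cardsU1 card_imset; last by move=> ? ? [].
by rewrite (_ : None \in _ = false) //; apply/imsetP=> -[].
Qed.

Lemma ext_symd u v : ext (symd u v) = symd (ext u) (ext v).
Proof. by apply/setP=> -[i|]; rewrite !inE // (functional_odd T). Qed.

Lemma ext_linear C : linear_code C -> linear_code (ext_code C).
Proof.
case=> C0 CD; split=> [|_ _ /imsetP[u uC ->] /imsetP[v vC ->]].
  apply/imsetP; exists set0 => //; apply/setP=> -[i|]; rewrite !inE //.
  by rewrite wt0.
by rewrite -ext_symd imset_f // CD.
Qed.

Lemma wt_ext u : wt ext_coords (ext u) = wt T u + odd (wt T u).
Proof.
rewrite wtE big_setU1 /=; last by apply/imsetP=> -[].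
rewrite big_imset /=; last by move=> ? ? _ _ [].
by rewrite addnC inE wtE; congr (_ + _); apply: eq_bigr => i _; rewrite some_ext.
Qed.

Lemma ext_even C : {in ext_code C, forall u, ~~ odd (wt ext_coords u)}.
Proof. by move=> _ /imsetP[u _ ->]; rewrite wt_ext; case: (wt T u) => *; clia. Qed.

Lemma ext_min_dist C d : odd d -> min_dist C T d ->
  min_dist (ext_code C) ext_coords d.+1.
Proof.
move=> od md _ /imsetP[u uC ->] uN; rewrite wt_ext.
have {uN} : u != set0.
  apply: contraNneq uN => ->; apply/eqP/setP=> -[i|]; rewrite !inE //.
  by rewrite wt0.
by move/(md u uC); clia.
Qed.

Lemma ext_eqc C i j : eqc (ext_code C) (Some i) (Some j) = eqc C i j.
Proof.
apply/eqcP/eqcP=> h u; first by move=> uC; rewrite -!some_ext h ?imset_f.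
by case/imsetP=> v vC ->; rewrite !some_ext h.
Qed.

Lemma ext_tri C i j l :
  tri (ext_code C) (Some i) (Some j) (Some l) = tri C i j l.
Proof.
apply/triP/triP=> h u; first by move=> uC; rewrite -!some_ext h ?imset_f.
by case/imsetP=> v vC ->; rewrite !some_ext h.
Qed.

Lemma ext_zerocol C i : zerocol (ext_code C) (Some i) = zerocol C i.
Proof.
apply/zerocolP/zerocolP=> h u; first by move=> uC; rewrite -some_ext h ?imset_f.
by case/imsetP=> v vC ->; rewrite !some_ext h.
Qed.

End Extension.

Definition no_code k m d := forall (I : finType) (C : {set {set I}}) (T : {set I}),
  linear_code C -> #|C| = 2 ^ k -> #|T| = m -> ~ min_dist C T d.

Definition no_even_code k m d :=
  forall (I : finType) (C : {set {set I}}) (T : {set I}),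
  linear_code C -> #|C| = 2 ^ k -> #|T| = m -> min_dist C T d ->
  ~ {in C, forall u, ~~ odd (wt T u)}.

Lemma no_code_even k m d : no_code k m d -> no_even_code k m d.
Proof. by move=> nc I C T linC cardC cardT md _; exact: nc md. Qed.

Lemma no_code_gr k m d : m < gr k d -> no_code k m d.
Proof.
move=> h I C T linC cardC cardT md.
by have := griesmer_bound linC (eq_leq (esym cardC)) md; clia.
Qed.

Lemma no_even_no_code_punctured k m d : odd d ->
  no_even_code k m.+1 d.+1 -> no_code k m d.
Proof.
move=> od nec I C T linC cardC cardT md.
apply: (nec _ (ext_code T C) (ext_coords T)); rewrite ?card_ext_code ?card_ext_coords ?cardT //.
- exact: ext_linear.
- exact: ext_min_dist.
exact: ext_even.
Qed.

Lemma no_code_puncture k m d : no_code k m d -> no_code k m.+1 d.+1.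
Proof.
move=> nc I C T linC cardC cardT md.
have /card_gt0P[t tT] : 0 < #|T| by rewrite cardT.
apply: (nc I C (T :\ t)) => //; first by have := cardsD1 t T; rewrite tT; clia.
move=> u uC uN; have := md u uC uN; rewrite !wtE (big_setD1 t) //=.
by case: (t \in u); clia.
Qed.

(** Puncturing and then extending by parity restores length and distance with all weights even, so
    for even distance only even codes need to be excluded. *)
Lemma no_even_no_code k m d : odd d ->
  no_even_code k m.+1 d.+1 -> no_code k m.+1 d.+1.
Proof. by move=> od nec; exact/no_code_puncture/no_even_no_code_punctured. Qed.

Section NoCode.

Variables (k m d : nat) (I : finType) (C : {set {set I}}) (T : {set I}).
Hypotheses (linC : linear_code C) (cardC : #|C| = 2 ^ k.+1) (cardT : #|T| = m).
Hypothesis md : min_dist C T d.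

Lemma no_weight w : no_code k (m - w) (d - w./2) ->
  {in C, forall c, c != set0 -> wt T c != w}.
Proof.
move=> nc c cC cN; apply/eqP=> wc.
have [C' [linC' cardC' md']] := residual_code linC cardC md cC cN.
apply: (nc _ _ _ linC' cardC' _); last by rewrite -wc; exact: md'.
by have := cardsID c T; rewrite setIC -/(wt T c); clia.
Qed.

Lemma no_weight_gr w : m - w < gr k (d - w./2) ->
  {in C, forall c, c != set0 -> wt T c != w}.
Proof. by move=> h; apply/no_weight/no_code_gr. Qed.

Lemma no_zerocol : no_code k.+1 m.-1 d -> {in T, forall i, ~~ zerocol C i}.
Proof.
move=> nc i iT; apply/negP=> /zerocolP zi.
apply: (nc _ _ (T :\ i) linC cardC).
  by have := cardsD1 i T; rewrite iT; clia.
by apply: min_dist_vanish md => u j uC; rewrite inE => /eqP ->; exact: zi.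
Qed.

(** Shortening at a repeated point costs one dimension but frees two coordinates. *)
Lemma no_double : no_code k (m - 2) d -> {in T, forall i, ~~ zerocol C i} ->
  {in T, forall i, mult C T i <= 1}.
Proof.
move=> nc nz i iT; rewrite leqNgt; apply/negP=> /(mult_gt1P _ iT)[j [jT ji e]].
apply: (nc _ (short C i) (T :\: [set i; j]) (short_linear linC i)).
- by have := card_short linC (nz i iT); rewrite cardC expnS; clia.
- have := cardsID [set i; j] T; rewrite (setIidPr _) ?cards2 1?eq_sym ?ji; first clia.
  by apply/subsetP=> x; rewrite !inE => /orP[] /eqP ->.
exact: short_vanish.
Qed.

Lemma moments (ws : seq nat) : 0 < d -> {in T, forall i, ~~ zerocol C i} ->
    {in C, forall u, u != set0 -> wt T u \in ws} -> uniq (0 :: ws) ->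
  [/\ 1 + \sum_(w <- ws) nwt C T w = 2 ^ k.+1,
      2 * \sum_(w <- ws) w * nwt C T w = 2 ^ k.+1 * m &
      4 * \sum_(w <- ws) w * w * nwt C T w = 2 ^ k.+1 * (m * m + eqpairs C T)].
Proof.
move=> d0 nz inws uws; rewrite -cardC -cardT.
exact: power_moments d0 md nz uws (weights_in inws).
Qed.

Lemma weight_attained : m < gr k.+1 d.+1 ->
  exists c, [/\ c \in C, c != set0 & wt T c = d].
Proof.
move=> h; case: (pickP [pred c in C | (c != set0) && (wt T c == d)]) => [c|no].
  by case/and3P=> cC cN /eqP e; exists c.
have := @griesmer_bound _ k.+1 C T d.+1 linC; rewrite cardC leqnn cardT.
suff md1 : min_dist C T d.+1 by move=> /(_ isT md1); clia.
move=> u uC uN; have := no u; have := md uC uN; rewrite /= uC uN /=.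
by case: ltngtP => // e _ /eqP; clia.
Qed.

End NoCode.

(** The length is too small for distance [d.+1], so weight [d] occurs, and the residual at such a
    word is the code assumed not to exist. *)
Lemma no_code_residual k m d : m < gr k.+1 d.+1 ->
  no_code k (m - d) (d - d./2) -> no_code k.+1 m d.
Proof.
move=> h nc I C T linC cardC cardT md.
have [c [cC cN wc]] := weight_attained linC cardC cardT md h.
by have /eqP := no_weight linC cardC cardT md nc cC cN.
Qed.

(** * Codes that do not exist *)

(** The word count and the first moment would force five words of weight 8, but two such words are
    already too close. *)
Lemma no_even_code_9_5_4 : no_even_code 5 9 4.
Proof.
move=> I C T linC cardC cardT md ev.
have nz := no_zerocol linC cardC cardT md (@no_code_gr 5 8 4 isT).
have ws : {in C, forall u, u != set0 -> wt T u \in [:: 4; 8]}.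
  move=> u uC uN; have := no_weight_gr linC cardC cardT md (w := 6) isT uC uN.
  by have := md u uC uN; have := ev u uC; have := wt_le T u; rewrite !inE; clia.
have := moments linC cardC cardT md isT nz ws isT.
have := nwt_le1 (w := 8) linC md; rewrite cardT => /(_ isT).
by rewrite !(big_cons, big_nil) /= => a1 []; clia.
Qed.

Lemma no_code_9_5_4 : no_code 5 9 4.
Proof. exact: no_even_no_code no_even_code_9_5_4. Qed.

Lemma no_code_8_5_3 : no_code 5 8 3.
Proof. exact: no_even_no_code_punctured no_even_code_9_5_4. Qed.

(** With zero or one word of weight 12 the moments give [eqpairs] the value 9 or 12, less than the
    13 diagonal pairs. *)
Lemma no_even_code_13_5_6 : no_even_code 5 13 6.
Proof.
move=> I C T linC cardC cardT md ev.
have nz := no_zerocol linC cardC cardT md (@no_code_gr 5 12 6 isT).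
have ws : {in C, forall u, u != set0 -> wt T u \in [:: 6; 8; 12]}.
  move=> u uC uN; have := no_weight_gr linC cardC cardT md (w := 10) isT uC uN.
  by have := md u uC uN; have := ev u uC; have := wt_le T u; rewrite !inE; clia.
have := moments linC cardC cardT md isT nz ws isT.
have := nwt_le1 (w := 12) linC md; rewrite cardT => /(_ isT).
have := geq_eqpairs C T; rewrite cardT.
by rewrite !(big_cons, big_nil) /= => h1 h2 [];  clia.
Qed.

Lemma no_code_13_5_6 : no_code 5 13 6.
Proof. exact: no_even_no_code no_even_code_13_5_6. Qed.

Lemma no_code_12_5_5 : no_code 5 12 5.
Proof. exact: no_even_no_code_punctured no_even_code_13_5_6. Qed.

Lemma no_code_25_6_12 : no_code 6 25 12.
Proof. exact: (@no_code_residual 5 25 12 isT no_code_13_5_6). Qed.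

Lemma no_code_22_6_10 : no_code 6 22 10.
Proof. exact: (@no_code_residual 5 22 10 isT no_code_12_5_5). Qed.

(** Summed over the nonzero words, (w - 20)(w - 24) gives 64. Each word of weight 32 or 40 exceeds
    this alone, and each word of weight 26 contributes 12, which does not divide 64. *)
Lemma no_even_code_41_6_20 : no_even_code 6 41 20.
Proof.
move=> I C T linC cardC cardT md ev.
have nz := no_zerocol linC cardC cardT md (@no_code_gr 6 40 20 isT).
have E2 := eqpairs1 (no_double linC cardC cardT md (@no_code_gr 5 39 20 isT) nz).
have ws : {in C, forall u, u != set0 -> wt T u \in [:: 20; 24; 26; 32; 40]}.
  have nw w h := @no_weight_gr _ _ _ _ _ _ linC cardC cardT md w h.
  have n28 := no_weight linC cardC cardT md (w := 28) no_code_13_5_6.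
  move=> u uC uN; move: (n28 u uC uN) (nw 22 isT u uC uN) (nw 30 isT u uC uN)
    (nw 34 isT u uC uN) (nw 36 isT u uC uN) (nw 38 isT u uC uN).
  by have := md u uC uN; have := ev u uC; have := wt_le T u; rewrite !inE; clia.
have := moments linC cardC cardT md isT nz ws isT.
by rewrite E2 !(big_cons, big_nil) /=; case; clia.
Qed.

Lemma no_code_41_6_20 : no_code 6 41 20.
Proof. exact: no_even_no_code no_even_code_41_6_20. Qed.

(** All remaining weights are multiples of 14, but the total weight 32 * 29 = 928 is not. *)
Lemma no_even_code_29_6_14 : no_even_code 6 29 14.
Proof.
move=> I C T linC cardC cardT md ev.
have nz := no_zerocol linC cardC cardT md (@no_code_gr 6 28 14 isT).
have ws : {in C, forall u, u != set0 -> wt T u \in [:: 14; 28]}.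
  have nw w h := @no_weight_gr _ _ _ _ _ _ linC cardC cardT md w h.
  have n16 := no_weight linC cardC cardT md (w := 16) no_code_13_5_6.
  have n20 := no_weight linC cardC cardT md (w := 20) no_code_9_5_4.
  move=> u uC uN; move: (n16 u uC uN) (n20 u uC uN) (nw 18 isT u uC uN)
    (nw 22 isT u uC uN) (nw 24 isT u uC uN) (nw 26 isT u uC uN).
  by have := md u uC uN; have := ev u uC; have := wt_le T u; rewrite !inE; clia.
have := moments linC cardC cardT md isT nz ws isT.
by rewrite !(big_cons, big_nil) /=; case; clia.
Qed.

Lemma no_code_29_6_14 : no_code 6 29 14.
Proof. exact: no_even_no_code no_even_code_29_6_14. Qed.

Lemma no_code_17_6_8 : no_code 6 17 8.
Proof. exact: (@no_code_residual 5 17 8 isT no_code_9_5_4). Qed.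

Lemma no_code_13_6_5 : no_code 6 13 5.
Proof. exact: (@no_code_residual 5 13 5 isT no_code_8_5_3). Qed.

(** * Lines *)

Lemma even_sum_symmetric (I : finType) (F : I -> I -> nat) (T : {set I}) :
    (forall i j, F i j = F j i) -> (forall i, ~~ odd (F i i)) ->
  ~~ odd (\sum_(i in T) \sum_(j in T) F i j).
Proof.
move=> Fsym Fdiag; have [n] := ubnP #|T|; elim: n T => // n IHn T leTn.
have [->|[x xT]] := set_0Vmem T; first by rewrite big_set0.
have cT : #|T :\ x| < n by have := cardsD1 x T; rewrite xT; lia.
have := IHn _ cT; rewrite [X in _ -> ~~ odd X](big_setD1 x) //=.
rewrite (big_setD1 x (F := F x)) //=.
have -> : \sum_(i in T :\ x) \sum_(j in T) F i j
    = \sum_(i in T :\ x) F x i + \sum_(i in T :\ x) \sum_(j in T :\ x) F i j.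
  by rewrite -big_split; apply: eq_bigr => i _ /=; rewrite (big_setD1 x) //= Fsym.
have := Fdiag x; move: (\sum_(i in T :\ x) \sum_(j in T :\ x) F i j).
by move: (\sum_(i in T :\ x) F x i) => a b; lia.
Qed.

Section Lines.

Variable I : finType.
Implicit Types (i j l x y z : I) (u v c : {set I}) (T D : {set I}).
Implicit Types (C : {set {set I}}).

Lemma vanish_bound k C T D d : linear_code C -> 2 ^ k <= #|C| -> min_dist C T d ->
  D \subset T -> {in C & D, forall u i, i \notin u} -> gr k d + #|D| <= #|T|.
Proof.
move=> linC cardC md DT vD.
have := griesmer_bound linC cardC (min_dist_vanish vD md).
by have := cardsID D T; rewrite (setIidPr DT); clia.
Qed.

Lemma card_eqc C T x : #|[set j in T | eqc C x j]| = mult C T x.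
Proof.
rewrite /mult -sum1_card big_mkcond [RHS]big_mkcond; apply: eq_bigr => j _ /=.
by rewrite inE; case: (j \in T); case: (eqc C x j).
Qed.

Lemma short_card_exp k C x : linear_code C -> #|C| = 2 ^ k.+1 -> ~~ zerocol C x ->
  #|short C x| = 2 ^ k.
Proof. by move=> linC cardC nz; have := card_short linC nz; rewrite cardC expnS; clia. Qed.

Lemma mult_bound k C T d x : linear_code C -> #|C| = 2 ^ k.+1 -> min_dist C T d ->
  ~~ zerocol C x -> gr k d + mult C T x <= #|T|.
Proof.
move=> linC cardC md nz; rewrite -card_eqc.
apply: (@vanish_bound _ (short C x)).
- exact: short_linear.
- by rewrite (short_card_exp linC cardC).
- exact: ker_min_dist.
- by apply/subsetP=> i; rewrite inE => /andP[].
move=> u i; rewrite !inE => /andP[uC xu] /andP[_ /eqcP e].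
by rewrite -e.
Qed.

Lemma tri_eqc12 C x y z : tri C x y z -> eqc C x y -> zerocol C z.
Proof.
move=> /triP t /eqcP e; apply/zerocolP=> u uC; move: (t u uC) (e u uC).
by do !case: (_ \in _).
Qed.

Lemma tri_eqc13 C x y z : tri C x y z -> eqc C x z -> zerocol C y.
Proof. by rewrite tri_swap; exact: tri_eqc12. Qed.

Lemma tri_eqc23 C x y z : tri C x y z -> eqc C y z -> zerocol C x.
Proof. by rewrite tri_rot; exact: tri_eqc13. Qed.

Lemma tri_neq C T x y z : {in T, forall i, ~~ zerocol C i} ->
  x \in T -> y \in T -> z \in T -> tri C x y z -> [/\ x != y, x != z & y != z].
Proof.
move=> nz xT yT zT t; split.
- by apply: contraNneq (nz z zT) => xy; rewrite (tri_eqc12 t) // xy eqc_refl.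
- by apply: contraNneq (nz y yT) => xz; rewrite (tri_eqc13 t) // xz eqc_refl.
by apply: contraNneq (nz x xT) => yz; rewrite (tri_eqc23 t) // yz eqc_refl.
Qed.

(* A point of multiplicity at least 2 on a full line makes the line carry four
   coordinates, all of which vanish on a subcode of codimension 2. *)
Lemma line_mult1 k C T d x y z : linear_code C -> #|C| = 2 ^ k.+2 -> min_dist C T d ->
    {in T, forall i, ~~ zerocol C i} -> #|T| < gr k d + 4 ->
    x \in T -> y \in T -> z \in T -> tri C x y z -> mult C T x = 1.
Proof.
move=> linC cardC md nz lt4 xT yT zT t.
apply/eqP; rewrite eqn_leq mult_gt0 // andbT leqNgt; apply/negP.
case/(mult_gt1P _ xT)=> x' [x'T x'x e].
have linS := short_linear linC x.
have nzS : ~~ zerocol (short C x) y.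
  rewrite zerocol_short // negb_or nz //; apply/negP=> yx.
  by case/negP: (nz z zT); apply: (tri_eqc12 t); rewrite eqc_sym.
have cardSS := short_card_exp linS (short_card_exp linC cardC (nz x xT)) nzS.
have linSS := short_linear linS y.
pose D := x |: (x' |: (y |: [set z])).
have : gr k d + #|D| <= #|T|.
  apply: (vanish_bound linSS); first by rewrite cardSS.
  - by do 2!apply: ker_min_dist.
  - by apply/subsetP=> i; rewrite !inE => /or4P[] /eqP ->.
  move=> u i; rewrite !inE => /andP[/andP[uC xu] yu].
  case/or4P=> /eqP -> //; first by rewrite -(eqcP _ _ _ e).
  have := triP _ _ _ _ t u uC.
  by rewrite (negbTE xu) (negbTE yu) => /= <-.
suff -> : #|D| = 4 by clia.
have [xy xz yz] := tri_neq nz xT yT zT t.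
have x'y : x' != y.
  by apply: contraNneq (nz z zT) => xy'; rewrite (tri_eqc12 t) // -xy'.
have x'z : x' != z.
  by apply: contraNneq (nz y yT) => xz'; rewrite (tri_eqc13 t) // -xz'.
rewrite /D !cardsU1 !inE cards1 !negb_or (eq_sym x) x'x xy xz x'y x'z yz.
by [].
Qed.

(** Double counting: a word of weight [w] survives the shortening at exactly [#|T| - w]
    coordinates. *)
Lemma sum_nwt_short C T w :
  \sum_(x in T) nwt (short C x) T w = (#|T| - w) * nwt C T w.
Proof.
have h x : nwt (short C x) T w = \sum_(u in [set u in C | wt T u == w]) (x \notin u).
  rewrite /nwt -sum1_card big_mkcond [RHS]big_mkcond; apply: eq_bigr => u _ /=.
  by rewrite !inE; case: (u \in C); case: (x \in u); case: (_ == _).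
rewrite (eq_bigr _ (fun x _ => h x)) exchange_big /= mulnC -sum_nat_const.
apply: eq_bigr => u; rewrite inE => /andP[_ /eqP <-].
apply/eqP; rewrite eq_sym -(eqn_add2r (wt T u)) subnK ?wt_le // wtE -big_split -sum1_card.
by apply/eqP; apply: eq_bigr => i _ /=; case: (i \in u).
Qed.

Lemma leq_nwt_short C T w x : nwt (short C x) T w <= nwt C T w.
Proof. by apply: subset_leq_card; apply/subsetP=> u; rewrite !inE -andbA => /and3P[-> _ ->]. Qed.

Lemma nwt_short_vanish C T D x w : {in short C x & D, forall u i, i \notin u} ->
  nwt (short C x) (T :\: D) w = nwt (short C x) T w.
Proof.
move=> v; apply: eq_card => u; rewrite !inE; case uC: (u \in C) => //=.
by case xu: (x \in u) => //=; rewrite wt_vanish // => i; apply: v; rewrite inE uC xu.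
Qed.

Lemma multD1 C T x y : x \in T -> ~~ eqc C y x -> mult C (T :\ x) y = mult C T y.
Proof. by move=> xT /negbTE e; rewrite /mult [RHS](big_setD1 x) //= e. Qed.

Lemma mult1_neq C T x y : x \in T -> y \in T -> mult C T x = 1 -> y != x -> ~~ eqc C x y.
Proof.
move=> xT yT m1 yx; apply/negP=> e; suff: 1 < mult C T x by rewrite m1.
by apply/(mult_gt1P _ xT); exists y.
Qed.

(** Because [y] and [z] are simple points, the only pairs with sum [x] that meet the line are (y, z)
    and (z, y). *)
Lemma sumpairs_line C T x y z : {in T, forall i, ~~ zerocol C i} ->
    x \in T -> y \in T -> z \in T -> x != y -> x != z -> y != z -> tri C x y z ->
    mult C T y = 1 -> mult C T z = 1 ->
  sumpairs C T x = sumpairs C (T :\ x :\ y :\ z) x + 2.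
Proof.
move=> nz xT yT zT xy xz yz t my mz.
have yT' : y \in T :\ x by rewrite !inE eq_sym xy.
have zT' : z \in T :\ x :\ y by rewrite !inE eq_sym yz eq_sym xz.
have t' : tri C x z y by rewrite tri_swap.
have ry : \sum_(j in T :\ x) tri C x y j = 1.
  transitivity (mult C T z); last by [].
  rewrite /mult [RHS](big_setD1 x) //= (tri_eqc _ t) tri_swap tri_xx (negbTE (nz _ _)) //.
  by apply: eq_bigr => j _; rewrite (tri_eqc _ t).
have rz : \sum_(j in T :\ x) tri C x z j = 1.
  transitivity (mult C T y); last by [].
  rewrite /mult [RHS](big_setD1 x) //= (tri_eqc _ t') tri_swap tri_xx (negbTE (nz _ _)) //.
  by apply: eq_bigr => j _; rewrite (tri_eqc _ t').
rewrite -(sumpairsD1 _ nz) /sumpairs (big_setD1 y) //= ry (big_setD1 z) //= rz.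
rewrite addnA addnC; congr (_ + _); apply: eq_bigr => i.
rewrite !inE => /and4P[iz iy ix iT].
rewrite (big_setD1 y) //= (big_setD1 z) //= tri_swap -(tri_eqc _ t).
rewrite (negbTE (mult1_neq _ _ mz iz)) // tri_swap -(tri_eqc _ t').
by rewrite (negbTE (mult1_neq _ _ my iy)).
Qed.

End Lines.

(** * Even codes of length 30, dimension 6 and minimum distance 14 *)

(** The first two equations leave two spectra: three words of weight 16, or one of weight 20,
    besides weight 14. The latter needs [E = 57], beyond the bound 54 that comes from multiplicities
    at most 2. *)
Lemma quotient27_arith (a b c d E : nat) :
    1 + (a + (b + (c + (d + 0)))) = 2 ^ 4 ->
    2 * (14 * a + (16 * b + (20 * c + (24 * d + 0)))) = 2 ^ 4 * 27 ->
    4 * (14 * 14 * a + (16 * 16 * b + (20 * 20 * c + (24 * 24 * d + 0))))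
      = 2 ^ 4 * (27 * 27 + E) ->
  E <= 54 -> E = 51.
Proof.
move=> e1 e2 e3 le54; have e4 : b + 3 * c + 5 * d = 3 by lia.
have d0 : d = 0 by lia.
have c1 : c <= 1 by lia.
subst d; case: c c1 e1 e2 e3 e4 => [|[|//]] _ e1 e2 e3 e4.
  have b3 : b = 3 by lia.
  have a1 : a = 12 by lia.
  by subst a b; lia.
have b0 : b = 0 by lia.
have a1 : a = 14 by lia.
by subst a b; lia.
Qed.

(** This is (l - p)(l - q) >= 0 for [l] outside the open interval from [p] to [q], stronger than a
    square when congruences keep [l] out of the interval: residue 2 modulo 3 skips 10, and even
    multiples of 3 skip everything between 6 and 12. *)
Lemma sq_bound (p q l : nat) : l <= p \/ q <= l -> p <= q -> (p + q) * l <= l * l + p * q.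
Proof. by case=> h pq; nia. Qed.
Lemma sq_bound30 a l : 3 * a + 2 = l -> 20 * l <= l * l + 99.
Proof. by move=> e; apply: (@sq_bound 9 11) => //; lia. Qed.
Lemma sq_bound32 a b l : 3 * a + 10 * b = l -> b <= 1 -> ~~ odd l ->
  18 * l <= l * l + 72 + 8 * b.
Proof.
case: b => [|[|//]] e _ ol; first by rewrite addn0; apply: (@sq_bound 6 12) => //; lia.
by have := @sq_bound 10 16 l; lia.
Qed.
Lemma sq_bound38 l : 16 * l <= l * l + 64.
Proof. by apply: (@sq_bound 8 8) => //; lia. Qed.

Section EvenThirty.

Variables (I : finType) (C : {set {set I}}) (T : {set I}).
Hypotheses (linC : linear_code C) (cardC : #|C| = 2 ^ 6) (cardT : #|T| = 30).
Hypothesis md : min_dist C T 14.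

Let nz : {in T, forall i, ~~ zerocol C i}.
Proof. exact: no_zerocol linC cardC cardT md no_code_29_6_14. Qed.

Let mult_le2 x : x \in T -> mult C T x <= 2.
Proof. by move=> xT; have := mult_bound linC cardC md (nz xT); rewrite cardT /=; lia. Qed.

Let mult1 x y z : x \in T -> y \in T -> z \in T -> tri C x y z -> mult C T x = 1.
Proof. by apply: (line_mult1 linC cardC md nz); rewrite cardT. Qed.

Lemma sumpairs_double x (S : {set I}) : S \subset T -> x \in T -> 1 < mult C T x ->
  sumpairs C S x = 0.
Proof.
move=> /subsetP ST xT m2; rewrite /sumpairs big1 // => i /ST iT.
rewrite big1 // => j /ST jT.
by case t: (tri C x i j) => //; rewrite (mult1 xT iT jT t) in m2.
Qed.

Hypothesis ws : {in C, forall u, u != set0 -> wt T u \in [:: 14; 16; 20; 24]}.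

Let E2 := eqpairs C T.
Let lam x := sumpairs C T x.
Let a20 x := nwt (short C x) T 20.
Let a24 x := nwt (short C x) T 24.

(** The combination with weight polynomial (w - 14)(w - 16), which eliminates the two unknown
    frequencies of the smallest weights. *)
Lemma global_moment30 : 3 * nwt C T 20 + 10 * nwt C T 24 + 36 = 2 * E2.
Proof.
have := moments linC cardC cardT md isT nz ws isT.
by rewrite !(big_cons, big_nil) /= -/E2 => -[]; lia.
Qed.

Lemma nwt24_le1 : nwt C T 24 <= 1.
Proof. by apply: (nwt_le1 linC md); rewrite cardT. Qed.

Lemma local_moments30 x (D : {set I}) : x \in T -> D \subset T ->
    D = [set j in T | eqc C x j] ->
  let m := 30 - #|D| in
  [/\ 1 + (nwt (short C x) T 14 + nwt (short C x) T 16 + a20 x + a24 x) = 32,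
    2 * (14 * nwt (short C x) T 14 + 16 * nwt (short C x) T 16 + 20 * a20 x
      + 24 * a24 x) = 32 * m &
    4 * (196 * nwt (short C x) T 14 + 256 * nwt (short C x) T 16 + 400 * a20 x
      + 576 * a24 x)
    = 32 * (m * m + eqpairs C (T :\: D) + sumpairs C (T :\: D) x)].
Proof.
move=> xT DT eD m.
have vD : {in short C x & D, forall (u : {set I}) (i : I), i \notin u}.
  by move=> u i; rewrite eD !inE => /andP[uC xu] /andP[_ /eqcP <-].
have mdS := min_dist_vanish vD (ker_min_dist (f := fun u => x \in u) md).
have cardS := short_card_exp linC cardC (nz xT).
have cardTD : #|T :\: D| = m by have := cardsID D T; rewrite (setIidPr DT) cardT; lia.
have nzS : {in T :\: D, forall i, ~~ zerocol (short C x) i}.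
  move=> i; rewrite inE => /andP[iD iT]; rewrite zerocol_short // negb_or nz //=.
  by apply: contra iD => e; rewrite eD inE iT eqc_sym.
have wsS : {in short C x, forall u, u != set0 -> wt (T :\: D) u \in [:: 14; 16; 20; 24]}.
  move=> u uS uN; rewrite wt_vanish; last by move=> i iD; exact: vD.
  by apply: ws => //; move: uS; rewrite inE => /andP[].
have := moments (short_linear linC x) cardS cardTD mdS isT nzS wsS isT.
rewrite (eqpairs_short linC _ (nz xT)) !(big_cons, big_nil) /= !nwt_short_vanish //.
by rewrite -/(a20 x) -/(a24 x) => -[e1 e2 e3]; split; lia.
Qed.

Lemma local_single x : x \in T -> mult C T x = 1 -> 3 * a20 x + 10 * a24 x + 32 = lam x + E2.
Proof.
move=> xT m1.
have eD : [set x] = [set j in T | eqc C x j].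
  apply/setP=> j; rewrite !inE; case: eqVneq => [->|jx]; first by rewrite xT eqc_refl.
  by case jT: (j \in T) => //=; rewrite (negbTE (mult1_neq xT jT m1 jx)).
have := local_moments30 xT _ eD; rewrite sub1set cards1 => /(_ xT) /=.
rewrite (sumpairsD1 _ nz) -/(lam x).
by have := eqpairsD1 C xT; rewrite m1 -/E2 => e []; lia.
Qed.

(** A repeated point lies on no line, so [lam x = 0]. The last bound is the first moment of the
    shortened code of length 28: the excesses over 14 add up to 14, and weight 16 contributes a
    nonnegative part. *)
Lemma local_double x : x \in T -> 1 < mult C T x ->
  [/\ lam x = 0, 3 * a20 x + 10 * a24 x + 32 = E2 & 6 * a20 x + 10 * a24 x <= 14].
Proof.
move=> xT m2; have lam0 := sumpairs_double (subxx T) xT m2.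
have [y [yT yx e]] := mult_gt1P _ xT m2.
have m2' : mult C T x = 2 by have := mult_le2 xT; lia.
have DT : [set x; y] \subset T by apply/subsetP=> j; rewrite !inE => /orP[] /eqP ->.
have eD : [set x; y] = [set j in T | eqc C x j].
  apply/eqP; rewrite eqEcard card_eqc m2' cards2 eq_sym yx andbT.
  by apply/subsetP=> j; rewrite !inE => /orP[] /eqP ->; rewrite ?xT ?yT ?eqc_refl.
have := local_moments30 xT DT eD; rewrite cards2 eq_sym yx /=.
rewrite (sumpairs_double (subsetDl _ _) xT m2).
have yTx : y \in T :\ x by rewrite !inE yx.
have my : mult C (T :\ x) y = 1.
  have : mult C T y = 2.
    rewrite -m2'; apply: eq_bigr => j _; congr (nat_of_bool _).
    by apply/idP/idP; apply: eqc_trans; rewrite // eqc_sym.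
  by rewrite /mult (big_setD1 x) //= eqc_sym e => -[].
have := eqpairsD1 C xT; have := eqpairsD1 C yTx; rewrite setDDl my m2' -/E2.
by move=> e1 e2 []; split=> //; lia.
Qed.

Lemma local_moment30 x : x \in T -> 3 * a20 x + 10 * a24 x + 32 = lam x + E2.
Proof.
move=> xT; have := mult_gt0 C xT; rewrite leq_eqVlt => /orP[/eqP m1|m2].
  exact: local_single.
by have [-> ->] := local_double xT m2.
Qed.

Lemma sum_sumpairs30 :
  30 * nwt C T 20 + 60 * nwt C T 24 + 960 = \sum_(x in T) lam x + 30 * E2.
Proof.
have d20 : 3 * \sum_(x in T) a20 x = \sum_(x in T) 3 * a20 x by rewrite big_distrr.
have d24 : 10 * \sum_(x in T) a24 x = \sum_(x in T) 10 * a24 x by rewrite big_distrr.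
have e : \sum_(x in T) (3 * a20 x + 10 * a24 x + 32) = \sum_(x in T) (lam x + E2).
  by apply: eq_bigr => x; exact: local_moment30.
rewrite [X in X = _]big_split [X in _ = X]big_split [X in X + _ = _]big_split /= in e.
move: e; rewrite -d20 -d24 !sum_nat_const !sum_nwt_short cardT.
by move: (\sum_(x in T) lam x) => l; lia.
Qed.

Lemma sumpairs_even x : x \in T -> ~~ odd (lam x).
Proof.
move=> xT; apply: even_sum_symmetric => [i j|i]; first by rewrite tri_swap.
by rewrite tri_diag (negbTE (nz xT)).
Qed.

Lemma eqpairs_even30 : ~~ odd E2.
Proof.
have -> : E2 = \sum_(i in T) \sum_(j in T) (eqc C i j && (i != j)) + 30.
  rewrite -cardT -sum1_card -big_split; apply: eq_bigr => i iT /=.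
  rewrite /mult !(big_setD1 i iT) /= eqxx eqc_refl /= add0n addnC; congr (_ + _).
  by apply: eq_bigr => j; rewrite !inE eq_sym => /andP[-> _]; rewrite andbT.
rewrite oddD addbF even_sum_symmetric // => [i j|i]; last by rewrite eqxx andbF.
by rewrite eqc_sym eq_sym.
Qed.

(* The quotient by a full line is a [27,4,14] code, whose second moment is
   forced. *)
Lemma line_sumpairs30 x y z : x \in T -> y \in T -> z \in T -> tri C x y z ->
  lam x + lam y + lam z + E2 = 60.
Proof.
move=> xT yT zT t; have [xy xz yz] := tri_neq nz xT yT zT t.
have ty : tri C y x z by rewrite -tri_rot.
have tz : tri C z x y by rewrite (tri_rot C z) tri_swap.
have mx := mult1 xT yT zT t; have my := mult1 yT xT zT ty; have mz := mult1 zT xT yT tz.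
have linS := short_linear linC x; have linSS := short_linear linS y.
have cardS := short_card_exp linC cardC (nz xT).
have nzy : ~~ zerocol (short C x) y.
  by rewrite zerocol_short // negb_or nz //= (mult1_neq yT xT my).
have cardSS := short_card_exp linS cardS nzy.
have [D eD] : exists D, D = x |: (y |: [set z]) by eexists.
have [T3 eT3D] : exists T3, T3 = T :\: D by eexists.
have eT3 : T3 = T :\ x :\ y :\ z by rewrite eT3D eD !setDDl.
have yT' : y \in T :\ x by rewrite !inE eq_sym xy.
have zT' : z \in T :\ x :\ y by rewrite !inE eq_sym yz eq_sym xz.
have cardT3 : #|T3| = 27.
  move: cardT; rewrite eT3 (cardsD1 x) xT (cardsD1 y) yT' (cardsD1 z) zT'.
  by rewrite !add1n => -[].
have vD : {in short (short C x) y & D, forall (u : {set I}) (i : I), i \notin u}.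
  move=> u i; rewrite eD !inE => /andP[/andP[uC xu] yu] /or3P[] /eqP -> //.
  by rewrite (triP _ _ _ _ tz) // (negbTE xu) (negbTE yu).
have mdSS : min_dist (short (short C x) y) T3 14.
  by rewrite eT3D; apply: min_dist_vanish vD _; do 2!apply: ker_min_dist.
have nzSS : {in T3, forall i, ~~ zerocol (short (short C x) y) i}.
  move=> i; rewrite eT3 !inE => /and4P[iz iy ix iT].
  apply/negP; rewrite zerocol_short // => /orP[].
    rewrite zerocol_short // (negbTE (nz iT)) /= eqc_sym.
    by rewrite (negbTE (mult1_neq xT iT mx ix)).
  rewrite -(lt0b (eqc _ _ _)) eqc_short ?nz // addn_gt0 !lt0b eqc_sym.
  rewrite (negbTE (mult1_neq yT iT my iy)) /= tri_swap => /(tri_eqc z).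
  by rewrite t eqc_sym (negbTE (mult1_neq zT iT mz iz)).
have wsSS : {in short (short C x) y, forall u, u != set0 ->
    wt T3 u \in [:: 14; 16; 20; 24]}.
  move=> u uS uN; rewrite eT3D wt_vanish; last by move=> i iD; exact: vD.
  by apply: ws => //; move: uS; rewrite !inE => /andP[/andP[]].
have le54 : eqpairs (short (short C x) y) T3 <= 54.
  have := @leq_eqpairs _ (short (short C x) y) T3 2; rewrite cardT3; apply.
  by move=> i /nzSS nzi; have := mult_bound linSS cardSS mdSS nzi; rewrite cardT3 -(leq_add2l 25).
have := moments linSS cardSS cardT3 mdSS isT nzSS wsSS isT.
rewrite !(big_cons, big_nil) /= => -[e1 e2 e3].
have e51 := quotient27_arith e1 e2 e3 le54.
(* Modulo the whole line, columns agree when they are equal or differ by one of its three points,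
   and these four cases exclude each other. *)
have eqS : eqpairs (short (short C x) y) T3 = eqpairs C T3 + sumpairs C T3 x
    + (sumpairs C T3 y + sumpairs C T3 z).
  rewrite (eqpairs_short linS _ nzy) (eqpairs_short linC _ (nz xT)).
  suff -> : sumpairs (short C x) T3 y = sumpairs C T3 y + sumpairs C T3 z by [].
  rewrite /sumpairs -big_split; apply: eq_bigr => i _.
  by rewrite -big_split; apply: eq_bigr => j _; rewrite (tri_short linC _ _ (nz xT) t).
have eE : E2 = eqpairs C T3 + 3.
  have := eqpairsD1 C xT; have := eqpairsD1 C yT'; have := eqpairsD1 C zT'.
  rewrite -eT3 -/E2 mx (multD1 yT') ?(mult1_neq zT yT mz) //.
  rewrite (multD1 xT (mult1_neq zT xT mz xz)) (multD1 xT (mult1_neq yT xT my xy)).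
  rewrite my mz; move: E2 (eqpairs C T3) (eqpairs C (T :\ x)) (eqpairs C (T :\ x :\ y)).
  by clear; lia.
have lx := sumpairs_line nz xT yT zT xy xz yz t my mz.
have ly := sumpairs_line nz yT xT zT _ yz xz ty mx mz.
have lz := sumpairs_line nz zT xT yT _ _ xy tz mx my.
rewrite eq_sym in ly; rewrite !(eq_sym z) in lz.
have T3y : T :\ y :\ x :\ z = T3 by rewrite eT3 !setDDl setUCA.
have T3z : T :\ z :\ x :\ y = T3.
  by rewrite eT3 !setDDl setUCA [_ :|: [set z]]setUC.
rewrite /lam lx ly // lz // T3y T3z -eT3 eE; move: eqS; rewrite e51.
move: (eqpairs C T3) (sumpairs C T3 x) (sumpairs C T3 y) (sumpairs C T3 z).
by clear; lia.
Qed.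

(** Sum [line_sumpairs30] over ordered triples on lines: a point [x] occurs [lam x] times in each of
    the three positions. *)
Lemma sum_sumpairs_sq30 :
  3 * \sum_(x in T) lam x * lam x + E2 * \sum_(x in T) lam x
  = 60 * \sum_(x in T) lam x.
Proof.
pose S (F : I -> I -> I -> nat) :=
  \sum_(x in T) \sum_(y in T) \sum_(z in T) tri C x y z * F x y z.
have S1 : S (fun x _ _ => lam x) = \sum_(x in T) lam x * lam x.
  apply: eq_bigr => x _; rewrite {2}/lam /sumpairs big_distrl; apply: eq_bigr => y _.
  by rewrite big_distrl.
have S2 : S (fun _ y _ => lam y) = \sum_(x in T) lam x * lam x.
  rewrite /S exchange_big -S1; apply: eq_bigr => y _; apply: eq_bigr => x _.
  by apply: eq_bigr => z _; rewrite tri_rot.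
have S3 : S (fun _ _ z => lam z) = \sum_(x in T) lam x * lam x.
  rewrite -S2; apply: eq_bigr => x _; rewrite exchange_big; apply: eq_bigr => y _.
  by apply: eq_bigr => z _; rewrite tri_swap.
have Sc c : S (fun _ _ _ => c) = c * \sum_(x in T) lam x.
  rewrite big_distrr; apply: eq_bigr => x _; rewrite big_distrr; apply: eq_bigr => y _.
  by rewrite big_distrr; apply: eq_bigr => z _; rewrite mulnC.
have : S (fun x y z => lam x + lam y + lam z + E2) = S (fun _ _ _ => 60).
  apply: eq_bigr => x xT; apply: eq_bigr => y yT; apply: eq_bigr => z zT.
  by case t: (tri C x y z); rewrite ?mul0n ?(line_sumpairs30 xT yT zT t).
have SD F G : S (fun x y z => F x y z + G x y z) = S F + S G.
  rewrite /S -big_split; apply: eq_bigr => x _; rewrite -big_split.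
  apply: eq_bigr => y _; rewrite -big_split; apply: eq_bigr => z _ /=.
  by rewrite mulnDr.
rewrite (SD (fun x y z => lam x + lam y + lam z) (fun _ _ _ => E2)).
rewrite (SD (fun x y _ => lam x + lam y) (fun _ _ z => lam z)).
rewrite (SD (fun x _ _ => lam x) (fun _ y _ => lam y)).
rewrite S1 S2 S3 !Sc.
by move: (\sum_(x in T) lam x * lam x) (\sum_(x in T) lam x) => a b; clear; lia.
Qed.

(** Multiplicities are 1 or 2, so [2 - mult C T x] is the indicator of simple points. Repeated
    points carry no line and thereby drop out of the quadratic estimates. *)
Lemma sum_mult_defect : \sum_(x in T) (2 - mult C T x) + E2 = 60.
Proof.
rewrite /E2 /eqpairs -big_split (eq_bigr (fun=> 2)) ?sum_nat_const ?cardT //.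
by move=> x xT /=; rewrite subnK ?mult_le2.
Qed.

Lemma no_word24_code : False.
Proof.
(* A repeated point leaves 32, 35, 38 or 42 by [local_double]. Parity removes 35; the value 42 comes
   with a word of weight 24, and then [global_moment30] fails modulo 3. *)
have cE2 : E2 = 30 \/ E2 = 32 \/ E2 = 38.
  case: (pickP [pred x in T | 1 < mult C T x]) => [x /andP[/= xT m2]|no].
    right; have [_] := local_double xT m2.
    have := leq_nwt_short C T 24 x; rewrite -/(a24 x).
    move: global_moment30 nwt24_le1 eqpairs_even30.
    move: (nwt C T 20) (nwt C T 24) E2 (a20 x) (a24 x); clear; lia.
  left; rewrite -cardT /E2; apply: eqpairs1 => x xT.
  by have := no x; rewrite /= xT /= ltnNge => /negbFE.
have := sum_sumpairs_sq30; have := sum_sumpairs30; have := sum_mult_defect.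
have := sum_nwt_short C T 24; rewrite cardT.
have sq (c d e : nat) : (forall x, x \in T ->
      c * lam x <= lam x * lam x + d * (2 - mult C T x) + e * a24 x) ->
    c * \sum_(x in T) lam x <= \sum_(x in T) lam x * lam x
      + d * \sum_(x in T) (2 - mult C T x) + e * \sum_(x in T) a24 x.
  move=> h; rewrite !big_distrr -!big_split.
  by apply: leq_sum => x xT; exact: h.
have loc x : x \in T -> [/\ 3 * a20 x + 10 * a24 x + 32 = lam x + E2,
    ~~ odd (lam x), a24 x <= nwt C T 24 & mult C T x = 1 \/ mult C T x = 2 /\ lam x = 0].
  move=> xT; split; [exact: local_moment30|exact: sumpairs_even|exact: leq_nwt_short|].
  have := mult_le2 xT; have := mult_gt0 C xT; case: (mult C T x) (@local_double x xT).
    by [].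
  by case=> [|[|//]] h _ _; [left|right; split=> //; have [] := h isT].
move: global_moment30 nwt24_le1 sq loc; rewrite -/(\sum_(x in T) a24 x).
move: (\sum_(x in T) (2 - mult C T x)) (\sum_(x in T) lam x * lam x).
move: (\sum_(x in T) lam x) (\sum_(x in T) a24 x) (nwt C T 20) (nwt C T 24).
move=> sl s24 n20 n24 sd sq2 e1 n24le sq loc e2 e3 e4 e5.
(* In the three cases lam sums to 300, 240, 180 and its squares to 3000, 2240, 1320. The estimates
   [sq] then read 6000 <= 5970, 4320 <= 4304 and 2880 <= 2728. *)
case: cE2 => [|[]] eE; rewrite eE in e1 e3 e4 e5 loc.
- have n24_0 : n24 = 0 by clear -e1 n24le; lia.
  have := sq 20 99 0; suff h : forall x, x \in T ->
      20 * lam x <= lam x * lam x + 99 * (2 - mult C T x) + 0 * a24 x.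
    by move/(_ h); clear -e1 e2 e3 e4 e5 n24_0; lia.
  move=> x /loc[l1 _ l2 [->|[-> ->]]] //; rewrite addn0.
  by apply: (@sq_bound30 (a20 x)); clear -l1 l2 n24_0; lia.
- have := sq 18 72 8; suff h : forall x, x \in T ->
      18 * lam x <= lam x * lam x + 72 * (2 - mult C T x) + 8 * a24 x.
    by move/(_ h); clear -e1 e2 e3 e4 e5 n24le; lia.
  move=> x /loc[l1 l0 l2 [->|[-> ->]]] //.
  by apply: (@sq_bound32 (a20 x)) => //; clear -l1 l2 n24le; lia.
have := sq 16 64 0; suff h : forall x, x \in T ->
    16 * lam x <= lam x * lam x + 64 * (2 - mult C T x) + 0 * a24 x.
  by move/(_ h); clear -e1 e2 e3 e4 e5 n24le; lia.
by move=> x /loc[_ _ _ [->|[-> ->]]] //; rewrite addn0; exact: sq_bound38.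
Qed.

End EvenThirty.

(** * Codes with locality 2 that do not exist *)

Definition recoverable (I : finType) (C : {set {set I}}) (i : I) :=
  [\/ zerocol C i, exists2 j, j != i & eqc C i j |
      exists j l, [/\ j != i, l != i & tri C i j l]].

Definition no_lrc k m d := forall (I : finType) (C : {set {set I}}),
  linear_code C -> #|C| = 2 ^ k -> #|I| = m -> min_dist C [set: I] d ->
  ~ forall i, recoverable C i.

Section Recoverable.

Variable I : finType.
Implicit Types (i j l x y z : I) (u v c : {set I}) (T S : {set I}).
Implicit Types (C : {set {set I}}).

Lemma eqpairs_doubled C T S : S \subset T -> {in S, forall i, 1 < mult C T i} ->
  #|T| + #|S| <= eqpairs C T.
Proof.
move=> ST m2; have -> : #|S| = wt T S by rewrite /wt (setIidPl ST).
rewrite wtE -sum1_card -big_split; apply: leq_sum => i iT /=.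
by case iS: (i \in S); [exact: m2|exact: mult_gt0].
Qed.

Lemma full_word T c : wt T c = #|T| -> T \subset c.
Proof.
move=> e; apply/setIidPr; apply/eqP; rewrite eqEcard subsetIr /=.
by rewrite -/(wt T c) e.
Qed.

Lemma full_word_tri C c x y z : c \in C -> x \in c -> y \in c -> z \in c ->
  ~~ tri C x y z.
Proof.
by move=> cC xc yc zc; apply/negP=> /triP /(_ c cC); rewrite xc yc zc.
Qed.

End Recoverable.

(** Besides a word of weight 28 or 30 only weights 14 and 16 fit. The moments then give [eqpairs]
    the value 32 for weight 30 and a non-integer for weight 28; without such a word [no_word24_code]
    applies. *)
Lemma even_code30_full (I : finType) (C : {set {set I}}) (T : {set I}) :
    linear_code C -> #|C| = 2 ^ 6 -> #|T| = 30 -> min_dist C T 14 ->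
    {in C, forall u, ~~ odd (wt T u)} ->
  exists2 c, c \in C /\ T \subset c & eqpairs C T = 32.
Proof.
move=> linC cardC cardT md ev.
have nz := no_zerocol linC cardC cardT md no_code_29_6_14.
have n18 := no_weight linC cardC cardT md (w := 18) no_code_12_5_5.
have n22 := no_weight linC cardC cardT md (w := 22) no_code_8_5_3.
have n26 := @no_weight_gr _ _ _ _ _ _ linC cardC cardT md 26 isT.
have wts u : u \in C -> u != set0 ->
    [/\ 14 <= wt T u <= 30, ~~ odd (wt T u), wt T u != 18, wt T u != 22 & wt T u != 26].
  by move=> uC uN; split; auto; rewrite md // -cardT wt_le.
have light w c : c \in C -> wt T c = w -> 28 <= w ->
    {in C, forall u, u != set0 -> wt T u \in [:: 14; 16; w]}.
  move=> cC wc w28 u uC uN; rewrite !inE; case: (eqVneq u c) => [->|uc].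
    by rewrite wc eqxx !orbT.
  have := weight_sum_bound linC md uC cC uc; have [] := wts u uC uN.
  by rewrite cardT wc; clear -w28; lia.
have one w c : c \in C -> wt T c = w -> 28 <= w -> nwt C T w = 1.
  move=> cC wc w28; apply/eqP; rewrite eqn_leq (nwt_le1 linC md) ?cardT; last by clear -w28; lia.
  by apply/card_gt0P; exists c; rewrite inE cC wc eqxx.
case: (pickP [pred c in C | wt T c == 30]) => [c /andP[/= cC /eqP wc]|no30].
  exists c; first by split=> //; apply: full_word _; rewrite cardT.
  have := moments linC cardC cardT md isT nz (light 30 c cC wc isT) isT.
  rewrite !(big_cons, big_nil) /= (one 30 c cC wc isT).
  by move: (nwt _ _ _) (nwt _ _ _) (eqpairs _ _) => a b e; clear => -[]; lia.
case: (pickP [pred c in C | wt T c == 28]) => [c /andP[/= cC /eqP wc]|no28].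
  have := moments linC cardC cardT md isT nz (light 28 c cC wc isT) isT.
  rewrite !(big_cons, big_nil) /= (one 28 c cC wc isT).
  have := geq_eqpairs C T; rewrite cardT.
  by move: (nwt _ _ _) (nwt _ _ _) (eqpairs _ _) => a b e; clear => h []; lia.
case: (no_word24_code linC cardC cardT md) => u uC uN.
have /= := no30 u; have /= := no28 u; rewrite uC /= => h28 h30; have [] := wts u uC uN.
by rewrite !inE; move: h28 h30; clear; lia.
Qed.

Section ExtendAll.

Variable I : finType.
Implicit Types (i j l : I) (C : {set {set I}}).

Lemma mem_ext_coords (x : option I) : x \in ext_coords [set: I].
Proof. by case: x => [i|]; rewrite !inE //= imset_f. Qed.

Lemma card_ext_coordsT : #|ext_coords [set: I]| = #|I|.+1.
Proof. by rewrite card_ext_coords cardsT. Qed.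

Lemma ext_double C i j : j != i -> eqc C i j ->
  1 < mult (ext_code [set: I] C) (ext_coords [set: I]) (Some i).
Proof.
move=> ji e; apply/(mult_gt1P _ (mem_ext_coords _)); exists (Some j).
by rewrite mem_ext_coords ext_eqc.
Qed.

(* When a codeword is 1 everywhere, no three coordinates sum to zero, so
   locality can only come from repeated coordinates. *)
Lemma full_word_double C (c : {set option I}) i : c \in ext_code [set: I] C ->
  (forall j, Some j \in c) -> ~~ zerocol C i -> recoverable C i ->
  1 < mult (ext_code [set: I] C) (ext_coords [set: I]) (Some i).
Proof.
move=> cE cT nz [zi|[j ji e]|[j [l [_ _]]]]; first by rewrite zi in nz.
  exact: ext_double e.
rewrite -(ext_tri [set: I]) => t.
by have /negP := full_word_tri cE (cT i) (cT j) (cT l).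
Qed.

Lemma card_Some (S : {set I}) : #|Some @: S| = #|S|.
Proof. by apply: card_imset => ? ? []. Qed.

End ExtendAll.

Lemma no_lrc_29_6_13 : no_lrc 6 29 13.
Proof.
move=> I C linC cardC cardI md rec.
pose E := ext_code [set: I] C; pose T := ext_coords [set: I].
have cardT : #|T| = 30 by rewrite /T card_ext_coordsT cardI.
have cardE : #|E| = 2 ^ 6 by rewrite /E card_ext_code.
have linE : linear_code E := ext_linear _ linC.
have mdE : min_dist E T 14 := @ext_min_dist _ _ _ 13 isT md.
have [c [cE cT] e32] := even_code30_full linE cardE cardT mdE (@ext_even _ _ _).
have nz := no_zerocol linE cardE cardT mdE no_code_29_6_14.
suff: #|T| + #|Some @: [set: I]| <= eqpairs E T.
  by rewrite e32 cardT card_Some cardsT cardI.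
apply: eqpairs_doubled; first by apply/subsetP=> x _; exact: mem_ext_coords.
move=> _ /imsetP[i _ ->]; apply: (full_word_double cE) => // [j|].
  by rewrite (subsetP cT) ?mem_ext_coords.
by rewrite -(ext_zerocol [set: I]) nz ?mem_ext_coords.
Qed.

(** * Length 30 and distance 14 when some word has odd weight *)

Section ThirtyOdd.

Variables (I : finType) (C : {set {set I}}) (T : {set I}).
Hypotheses (linC : linear_code C) (cardC : #|C| = 2 ^ 6) (cardT : #|T| = 30).
Hypothesis md : min_dist C T 14.
Hypothesis oddC : ~~ [forall u in C, ~~ odd (wt T u)].

Let nz : {in T, forall i, ~~ zerocol C i}.
Proof. exact: no_zerocol linC cardC cardT md no_code_29_6_14. Qed.

(** Parity is a functional, so odd words are absent or make up half the code. This extra equation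
    compensates for the additional unknown weight 15. *)
Lemma sum_odd_nwt (A : {set {set I}}) (S : {set I}) (ws : seq nat) : linear_code A ->
    {in A, forall u, u != set0 -> wt S u \in ws} -> uniq (0 :: ws) ->
  2 * \sum_(w <- ws) odd w * nwt A S w = #|A| * ~~ [forall u in A, ~~ odd (wt S u)].
Proof.
move=> linA inws uws; rewrite -sum_functional //; last exact: functional_odd.
by rewrite (sum_by_weight (fun w => nat_of_bool (odd w)) uws (weights_in inws)) big_cons.
Qed.

Let po x := [forall u in short C x, ~~ odd (wt T u)].

(** If parity vanishes where coordinate [x] does, it is zero or equal to that coordinate, and [oddC]
    excludes zero. Hence all such coordinates coincide. *)
Lemma odd_coord x : po x -> {in C, forall u : {set I}, (x \in u) = odd (wt T u)}.
Proof.
move=> /forall_inP pox u uC.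
have [h|h] := vanish_ker linC (functional_coord x) (functional_odd T) pox.
  by case/forall_inP: oddC.
by rewrite h.
Qed.

Lemma odd_coord_eqc x y : po x -> po y -> eqc C x y.
Proof. by move=> /odd_coord px /odd_coord py; apply/eqcP=> u uC; rewrite px ?py. Qed.

Hypothesis ws : {in C, forall u, u != set0 -> wt T u \in [:: 14; 15; 16; 20; 24]}.

Lemma local_odd30 x : x \in T ->
  [/\ 1 + (nwt (short C x) T 14 + nwt (short C x) T 15 + nwt (short C x) T 16
        + nwt (short C x) T 20 + nwt (short C x) T 24) = 32,
     14 * nwt (short C x) T 14 + 15 * nwt (short C x) T 15 + 16 * nwt (short C x) T 16
        + 20 * nwt (short C x) T 20 + 24 * nwt (short C x) T 24
     = 16 * (30 - mult C T x) &
     nwt (short C x) T 15 = 16 * ~~ po x].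
Proof.
move=> xT; set D := [set j in T | eqc C x j].
have DT : D \subset T by apply/subsetP=> i; rewrite inE => /andP[].
have vD : {in short C x & D, forall (u : {set I}) (i : I), i \notin u}.
  by move=> u i; rewrite !inE => /andP[uC xu] /andP[_ /eqcP <-].
have mdS := min_dist_vanish vD (ker_min_dist (f := fun u => x \in u) md).
have cardS := short_card_exp linC cardC (nz xT).
have cardTD : #|T :\: D| = 30 - mult C T x.
  by rewrite -card_eqc -/D -cardT cardsD (setIidPr DT).
have nzS : {in T :\: D, forall i, ~~ zerocol (short C x) i}.
  move=> i; rewrite inE => /andP[iD iT]; rewrite zerocol_short // negb_or nz //=.
  by apply: contra iD => e; rewrite inE iT eqc_sym.
have wsS : {in short C x, forall u, u != set0 ->
    wt (T :\: D) u \in [:: 14; 15; 16; 20; 24]}.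
  move=> u uS uN; rewrite wt_vanish; last by move=> i iD; exact: vD.
  by apply: ws => //; move: uS; rewrite inE => /andP[].
have linS := short_linear linC x.
have := sum_odd_nwt linS wsS isT.
have := moments linS cardS cardTD mdS isT nzS wsS isT.
have -> : [forall u in short C x, ~~ odd (wt (T :\: D) u)] = po x.
  apply: eq_forallb => u; case uS: (u \in short C x) => //=.
  by rewrite wt_vanish // => i; exact: vD.
rewrite cardS !(big_cons, big_nil) /= !nwt_short_vanish //.
move: (nwt _ _ 14) (nwt _ _ 15) (nwt _ _ 16) (nwt _ _ 20) (nwt _ _ 24) (30 - _) (po x).
by clear => a b c d e m p [e1 e2 _] e4; split; case: p e4; lia.
Qed.

(** At a repeated coordinate whose shortened code has odd words, 16 words of weight 15 and 15 words
    of weight at least 14 exceed the total weight 448. So repeated coordinates equal the parity,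
    there is one such pair, and the global moments have no solution. With no repetition the moments
    exclude weight 16, and then every coordinate must equal the parity, which is absurd. *)
Lemma no_odd_word24_code : False.
Proof.
have a24 : nwt C T 24 <= 1 by apply: (nwt_le1 linC md); rewrite cardT.
have := sum_odd_nwt linC ws isT; have := moments linC cardC cardT md isT nz ws isT.
rewrite oddC cardC !(big_cons, big_nil) /= => -[e1 e2 e3] e4.
have mult_le2 x : x \in T -> mult C T x <= 2.
  by move=> xT; have := mult_bound linC cardC md (nz xT); rewrite cardT -(leq_add2l 28).
case: (pickP [pred x in T | 1 < mult C T x]) => [x /andP[/= xT m2]|no].
  have pod y : y \in T -> 1 < mult C T y -> po y.
    move=> yT my; have := local_odd30 yT; have := mult_le2 y yT.
    case: (po y) => // le2 [h1 h2 h3]; exfalso.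
    move: le2 h1 h2 h3 my; clear.
    move: (mult _ _ _) (nwt _ _ 14) (nwt _ _ 15) (nwt _ _ 16) (nwt _ _ 20) (nwt _ _ 24).
    by move=> m a b c d e; clear; lia.
  have mE y : y \in T -> mult C T y = 1 + eqc C x y.
    move=> yT; have := mult_gt0 C yT; rewrite leq_eqVlt => /orP[/eqP m1|my].
      case e: (eqc C x y); last by rewrite addn0.
      have : x != y by apply: contraTneq m2 => ->; rewrite -m1.
      by rewrite eqc_sym in e; move/(mult1_neq yT xT (esym m1)); rewrite e.
    rewrite odd_coord_eqc ?pod //.
    by apply/eqP; rewrite eqn_leq mult_le2.
  have E2 : eqpairs C T = 32.
    rewrite /eqpairs (eq_bigr _ mE) big_split sum1_card cardT -/(mult C T x) /=.
    have := mult_le2 x xT; move: m2; case: (mult C T x) => [|[|[|//]]] //.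
  move: e1 e2 e3 e4 a24; rewrite E2.
  move: (nwt _ _ 14) (nwt _ _ 15) (nwt _ _ 16) (nwt _ _ 20) (nwt _ _ 24).
  by clear => a b c d e; lia.
have m1 y : y \in T -> mult C T y <= 1.
  by move=> yT; have := no y; rewrite /= yT /= ltnNge => /negbFE.
have E2 : eqpairs C T = 30 by rewrite (eqpairs1 m1).
have a16 : nwt C T 16 = 0.
  move: e1 e2 e3 e4 a24; rewrite E2.
  move: (nwt _ _ 14) (nwt _ _ 15) (nwt _ _ 16) (nwt _ _ 20) (nwt _ _ 24).
  by clear => a b c d e; lia.
have pox y : y \in T -> po y.
  move=> yT; have := local_odd30 yT; case: (po y) => // -[h1 h2 h3]; exfalso.
  have my : mult C T y = 1 by apply/eqP; rewrite eqn_leq m1 // mult_gt0.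
  have := leq_nwt_short C T 16 y; have := leq_nwt_short C T 24 y.
  move: h1 h2 h3 a24; rewrite a16 my.
  move: (nwt C T 24) (nwt _ _ 14) (nwt _ _ 15) (nwt _ _ 16) (nwt _ _ 20) (nwt _ _ 24).
  by clear => f a b c d e; lia.
have /card_gt1P[x [y [xT yT xy]]] : 1 < #|T| by rewrite cardT.
have := m1 x xT; rewrite leqNgt => /negP; apply; apply/(mult_gt1P _ xT).
by exists y; split; rewrite // 1?eq_sym // odd_coord_eqc ?pox.
Qed.

End ThirtyOdd.

Lemma full_recoverable_eqpairs (I : finType) (C : {set {set I}}) c :
    c \in C -> [set: I] \subset c -> (forall i, ~~ zerocol C i) ->
  (forall i, recoverable C i) -> 2 * #|I| <= eqpairs C [set: I].
Proof.
move=> cC /subsetP cT nz rec.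
have <- : #|[set: I]| + #|[set: I]| = 2 * #|I| by rewrite cardsT mul2n addnn.
apply: eqpairs_doubled => // i _; case: (rec i) => [zi|[j ji e]|[j [l [_ _ t]]]].
- by have := nz i; rewrite zi.
- by apply/(mult_gt1P _ (in_setT _)); exists j.
have cT' x : x \in c by apply: cT.
by have := full_word_tri cC (cT' i) (cT' j) (cT' l); rewrite t.
Qed.

Lemma no_lrc_30_6_14 : no_lrc 6 30 14.
Proof.
move=> I C linC cardC cardI md rec; pose T := [set: I]; rewrite -/T in md.
have cardT : #|T| = 30 by rewrite cardsT.
have nz := no_zerocol linC cardC cardT md no_code_29_6_14.
have big_full c : c \in C -> wt T c = #|T| -> 60 <= eqpairs C T.
  move=> cC wc; have := @full_recoverable_eqpairs _ C c cC (full_word wc).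
  by rewrite cardI; apply=> // i; rewrite nz ?inE.
case: (boolP [forall u in C, ~~ odd (wt T u)]) => [/forall_inP ev|oddC].
  have [c [cC cT] e32] := even_code30_full linC cardC cardT md ev.
  by have := big_full c cC; rewrite e32 /wt (setIidPr cT) => /(_ erefl).
have nw w h := @no_weight_gr _ _ _ _ _ _ linC cardC cardT md w h.
have n17 := no_weight linC cardC cardT md (w := 17) no_code_13_5_6.
have n18 := no_weight linC cardC cardT md (w := 18) no_code_12_5_5.
have n21 := no_weight linC cardC cardT md (w := 21) no_code_9_5_4.
have n22 := no_weight linC cardC cardT md (w := 22) no_code_8_5_3.
have wts : {in C, forall u, u != set0 ->
    wt T u \in [:: 14; 15; 16; 20; 24; 28; 29; 30]}.
  move=> u uC uN; move: (n17 u uC uN) (n18 u uC uN) (n21 u uC uN) (n22 u uC uN)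
    (nw 19 isT u uC uN) (nw 23 isT u uC uN) (nw 25 isT u uC uN) (nw 26 isT u uC uN)
    (nw 27 isT u uC uN) (md u uC uN) (wt_le T u).
  by rewrite cardT !inE; clear; lia.
have heavy w : 28 <= w -> {in C, forall c, wt T c = w ->
    [/\ {in C, forall u, u != set0 -> wt T u \in [:: 14; 15; 16; w]} & nwt C T w = 1]}.
  move=> w28 c cC wc; split=> [u uC uN|].
    rewrite !inE; case: (eqVneq u c) => [->|uc]; first by rewrite wc eqxx !orbT.
    have := weight_sum_bound linC md uC cC uc; have := wts u uC uN.
    by rewrite cardT wc !inE; clear -w28; lia.
  apply/eqP; rewrite eqn_leq (nwt_le1 linC md) ?cardT; last by clear -w28; lia.
  by apply/card_gt0P; exists c; rewrite inE cC wc eqxx.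
have E30 := geq_eqpairs C T; rewrite cardT in E30.
(* For weights 28 and 29 the second moment has no integral solution. For weight 30 it gives
   [eqpairs] the value 30, while locality next to an all-one word demands 60. *)
have no_heavy w c : w \in [:: 28; 29; 30] -> c \in C -> wt T c = w -> False.
  move=> w3 cC wc; have w28 : 28 <= w by move: w3; rewrite !inE; clear; lia.
  have [wsw n1] := heavy w w28 c cC wc.
  have uw : uniq [:: 0; 14; 15; 16; w].
    by move: w28; rewrite /= !inE; clear; lia.
  have := sum_odd_nwt linC wsw uw; have := moments linC cardC cardT md isT nz wsw uw.
  rewrite oddC cardC !(big_cons, big_nil) n1 /=; move: w3 E30 (big_full c cC).
  rewrite cardT wc; move: (nwt _ _ 14) (nwt _ _ 15) (nwt _ _ 16) (eqpairs _ _).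
  by rewrite !inE; clear => a b d e /or3P[] /eqP ->; move=> h1 h2 [e1 e2 e3] e4; lia.
apply: (no_odd_word24_code linC cardC cardT md oddC) => u uC uN.
have nh : wt T u \notin [:: 28; 29; 30] by apply/negP=> w3; exact: no_heavy w3 uC erefl.
by have := wts u uC uN; move: nh; rewrite !inE; clear; lia.
Qed.

(** * Length 14 and distance 5: the lines form blocks of size 3 *)

Lemma dvdn_card_blocks (I : finType) (f : I -> {set I}) n :
    (forall x, x \in f x) -> (forall x y, y \in f x -> f y = f x) ->
  (forall x, #|f x| = n) -> n %| #|I|.
Proof.
move=> fx fxy fn; rewrite -cardsT.
have fP : {in f @: [set: I], forall A : {set I}, #|A| = n}.
  by move=> _ /imsetP[x _ ->].
rewrite (card_uniform_partition fP) ?dvdn_mull //; apply/and3P; split.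
- apply/eqP/setP=> x; rewrite inE; apply/bigcupP; exists (f x) => //.
  by rewrite imset_f.
- apply/trivIsetP=> _ _ /imsetP[x _ ->] /imsetP[y _ ->] xy.
  rewrite -setI_eq0; apply: contraR xy => /set0Pn[z].
  by rewrite inE => /andP[/fxy <- /fxy <-].
by apply/imsetP=> -[x _ e]; have := fx x; rewrite -e inE.
Qed.

Lemma no_lrc_14_6_5 : no_lrc 6 14 5.
Proof.
move=> I C linC cardC cardI md rec; pose T := [set: I]; rewrite -/T in md.
have cardT : #|T| = 14 by rewrite cardsT.
have nz := no_zerocol linC cardC cardT md no_code_13_6_5.
have m1 := no_double linC cardC cardT md no_code_12_5_5 nz.
have line x : exists y z, tri C x y z.
  case: (rec x) => [zi|[j ji e]|[j [l [_ _ t]]]].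
  - by have := nz x (in_setT _); rewrite zi.
  - have := m1 x (in_setT _); rewrite leqNgt => /negP[].
    by apply/(mult_gt1P _ (in_setT _)); exists j.
  by exists j, l.
have triN x y z : tri C x y z -> [/\ x != y, x != z & y != z].
  by apply: tri_neq nz _ _ _; rewrite inE.
have third x y z a : tri C x y z -> tri C x y a -> a = z.
  move=> t1 t2; apply: contraTeq (m1 z (in_setT _)) => az; rewrite -ltnNge.
  apply/(mult_gt1P _ (in_setT _)); exists a; split=> //.
  by rewrite (tri_eqc _ t1).
(* Two lines through [x] would carry five coordinates, all vanishing on a subcode of dimension at
   least 3; such a subcode needs [gr 3 5 = 10] further ones. *)
have meet x y z a b : tri C x y z -> tri C x a b -> (a == y) || (a == z).
  move=> t1 t2; apply: contraT; rewrite negb_or => /andP[ay az].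
  have [xy xz yz] := triN _ _ _ t1; have [xa xb ab] := triN _ _ _ t2.
  have by_ : b != y.
    by apply: contraNneq az => bY; rewrite bY tri_swap in t2; rewrite (third _ _ _ _ t1 t2).
  have bz : b != z.
    apply: contraNneq ay => bZ; rewrite bZ tri_swap in t2; rewrite tri_swap in t1.
    by rewrite (third _ _ _ _ t1 t2).
  pose S := short (short (short C x) y) a.
  have linS : linear_code S by do 3!apply: short_linear.
  have cardS : 2 ^ 3 <= #|S|.
    have l1 := short_linear linC x; have l2 := short_linear l1 y.
    have := leq_card_short linC x; have := leq_card_short l1 y.
    by have := leq_card_short l2 a; rewrite cardC -/S; clear; clia.
  have mdS : min_dist S T 5 by do 3!apply: ker_min_dist.
  pose D := x |: (y |: (z |: (a |: [set b]))).
  have := vanish_bound (D := D) linS cardS mdS (subsetT _).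
  have -> : #|D| = 5.
    by rewrite /D !cardsU1 !inE cards1 !negb_or xy xz yz xa xb ab
      !(eq_sym z) !(eq_sym y) ay az by_ bz.
  rewrite cardT => h; suff /h : {in S & D, forall (u : {set I}) (i : I), i \notin u} by [].
  move=> u i; rewrite !inE => /andP[/andP[/andP[uC xu] yu] au].
  have := triP _ _ _ _ t1 u uC; have := triP _ _ _ _ t2 u uC.
  rewrite (negbTE xu) (negbTE yu) (negbTE au) => /esym/= bu /esym/= zu.
  by case/orP=> [/eqP->//|/or4P[] /eqP ->] //; rewrite ?bu ?zu.
pose f x := x |: [set y | [exists z, tri C x y z]].
have fE x y z : tri C x y z -> f x = x |: (y |: [set z]).
  move=> t; apply/setP=> a; rewrite !inE; congr (_ || _).
  apply/existsP/orP=> [[b t2]|]; first by apply/orP; apply: meet t t2.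
  by case=> /eqP ->; [exists z|exists y; rewrite tri_swap].
suff : 3 %| #|I| by rewrite cardI.
apply: (@dvdn_card_blocks _ f) => [x|x y|x]; first by rewrite !inE eqxx.
  have [a [b t]] := line x; rewrite (fE _ _ _ t) !inE.
  case/or3P=> /eqP ->; first by rewrite (fE _ _ _ t).
    by rewrite tri_rot in t; rewrite (fE _ _ _ t) setUCA.
  rewrite tri_swap tri_rot in t; rewrite (fE _ _ _ t).
  by apply/setP=> i; rewrite !inE; do !case: (_ == _).
have [a [b t]] := line x; rewrite (fE _ _ _ t); have [xa xb ab] := triN _ _ _ t.
by rewrite !cardsU1 !inE cards1 !negb_or xa xb ab.
Qed.

Lemma sumpairs_card (I : finType) (C : {set {set I}}) (T : {set I}) x :
  sumpairs C T x = #|[set p | [&& p.1 \in T, p.2 \in T & tri C x p.1 p.2]]|.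
Proof.
rewrite /sumpairs pair_big -sum1_card big_mkcond [RHS]big_mkcond /=.
by apply: eq_bigr => p _; rewrite inE andbA; case: (_ && _); case: (tri _ _ _ _).
Qed.

Lemma no_lrc_17_6_7 : no_lrc 6 17 7.
Proof.
move=> I C linC cardC cardI md rec.
pose E := ext_code [set: I] C; pose T := ext_coords [set: I].
have cardT : #|T| = 18 by rewrite /T card_ext_coordsT cardI.
have cardE : #|E| = 2 ^ 6 by rewrite /E card_ext_code.
have linE : linear_code E := ext_linear _ linC.
have mdE : min_dist E T 8 := @ext_min_dist _ _ _ 7 isT md.
have evE : {in E, forall u, ~~ odd (wt T u)} := @ext_even _ _ _.
have inT x : x \in T := mem_ext_coords x.
have nz := no_zerocol linE cardE cardT mdE no_code_17_6_8.
have ws : {in E, forall u, u != set0 -> wt T u \in [:: 8; 12; 16; 18]}.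
  have n10 := no_weight linE cardE cardT mdE (w := 10) no_code_8_5_3.
  have n14 := @no_weight_gr _ _ _ _ _ _ linE cardE cardT mdE 14 isT.
  move=> u uE uN; move: (n10 u uE uN) (n14 u uE uN) (mdE u uE uN) (evE u uE) (wt_le T u).
  by rewrite cardT !inE; clear; lia.
have n16 : nwt E T 16 <= 1 by apply: (nwt_le1 linE mdE); rewrite cardT.
have n18 : nwt E T 18 <= 1 by apply: (nwt_le1 linE mdE); rewrite cardT.
(* The weight polynomial (w - 8)(w - 12) leaves 8 a16 + 15 a18 = 4 (E - 18) for the numbers of words
   of weights 16 and 18; hence 4 divides a18, which is at most 1. *)
have [e16 e18] : eqpairs E T = 18 + 2 * nwt E T 16 /\ nwt E T 18 = 0.
  have := moments linE cardE cardT mdE isT nz ws isT.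
  rewrite !(big_cons, big_nil) /=; move: n16 n18.
  move: (nwt _ _ 8) (nwt _ _ 12) (nwt _ _ 16) (nwt _ _ 18) (eqpairs _ _).
  by clear => a b c d e h1 h2 [e1 e2 e3]; split; lia.
have loc x : mult E T x = 1 -> nwt (short E x) T 16 = 0 ->
    sumpairs E T x + eqpairs E T = 20.
  move=> m1 s16; have eD := eqpairsD1 E (inT x).
  have vD : {in short E x & [set x], forall (u : {set option I}) (i : option I), i \notin u}.
    by move=> u i; rewrite !inE => /andP[uE xu] /eqP ->.
  have mdS := min_dist_vanish vD (ker_min_dist (f := fun u => x \in u) mdE).
  have linS := short_linear linE x.
  have cardS := short_card_exp linE cardE (nz _ (inT x)).
  have cardTx : #|T :\ x| = 17 by move: cardT; rewrite (cardsD1 x) inT => -[].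
  have nzS : {in T :\ x, forall i, ~~ zerocol (short E x) i}.
    move=> i /setD1P[ix iT]; rewrite zerocol_short // negb_or nz //=.
    by rewrite eqc_sym (mult1_neq (inT x) iT m1 ix).
  have wsS : {in short E x, forall u, u != set0 -> wt (T :\ x) u \in [:: 8; 12; 16; 18]}.
    move=> u uS uN; rewrite wt_vanish; last by move=> i iD; exact: vD.
    by apply: ws => //; move: uS; rewrite inE => /andP[].
  have := moments linS cardS cardTx mdS isT nzS wsS isT.
  rewrite (eqpairs_short linE _ (nz _ (inT x))) (sumpairsD1 _ nz).
  have s18 := leq_nwt_short E T 18 x; rewrite e18 leqn0 in s18.
  rewrite !(big_cons, big_nil) /= !nwt_short_vanish // s16 (eqP s18).
  move: eD; rewrite m1; move: (nwt _ _ 8) (nwt _ _ 12) (eqpairs _ _) (eqpairs _ _).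
  move: (sumpairs _ _ _); clear => s a b c d e1 [e2 e3 e4]; lia.
have doubled (S : {set option I}) : {in S, forall i, 1 < mult E T i} ->
    18 + #|S| <= eqpairs E T.
  by rewrite -cardT; apply: eqpairs_doubled; apply/subsetP=> x _; exact: inT.
have recE i : mult E T (Some i) <= 1 -> exists j l, tri E (Some i) (Some j) (Some l).
  rewrite leqNgt => m1; case: (rec i) => [zi|[j ji e]|[j [l [ji li t]]]].
  - by have := nz (Some i) (inT _); rewrite ext_zerocol zi.
  - by have := ext_double ji e; rewrite (negbTE m1).
  by exists j, l; rewrite ext_tri.
case: (posnP (nwt E T 16)) => [z16|p16].
  have m1 x : mult E T x = 1.
    apply/eqP; rewrite eqn_leq mult_gt0 // andbT leqNgt; apply/negP=> m2.
    have := doubled [set x]; rewrite e16 z16 cards1 => h.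
    by suff: 18 + 1 <= 18 + 2 * 0 by []; apply: h => y; rewrite inE => /eqP ->.
  have lam2 x : sumpairs E T x = 2.
    have := loc x (m1 x); rewrite e16 z16; have := leq_nwt_short E T 16 x.
    rewrite z16 leqn0 => /eqP -> /(_ erefl) /eqP.
    by rewrite -[20]/(2 + (18 + 2 * 0)) eqn_add2r => /eqP.
  have := lam2 None; rewrite sumpairs_card.
  case: (set_0Vmem [set p | [&& p.1 \in T, p.2 \in T & tri E None p.1 p.2]]).
    by move->; rewrite cards0.
  case=> -[y z]; rewrite inE /= => /and3P[_ _ t] _.
  have [ny nz' yz] := tri_neq nz (inT _) (inT _) (inT _) t.
  case: y ny t yz => [y|//] _ t yz; case: z nz' t yz => [z|//] _ t yz.
  (* Locality recovers [y] inside [C], hence on a line avoiding the parity coordinate and different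
     from the one through [None] and [z]. That makes three ordered pairs at [y], where [lam2] allows
     two. *)
  have [j [l t2]] : exists j l, tri E (Some y) (Some j) (Some l) by apply: recE; rewrite m1.
  have := lam2 (Some y); rewrite sumpairs_card.
  set A := [set p | _] => cA.
  pose B := (None, Some z) |: ((Some z, None) |: [set (Some j, Some l)]).
  have : #|B| <= #|A|.
    apply/subset_leq_card/subsetP=> p /setU1P[->|/setU1P[->|/set1P->]];
      rewrite in_set /=.
    - by rewrite !inT -tri_rot t.
    - by rewrite !inT tri_swap -tri_rot t.
    by rewrite !inT t2.
  by rewrite cA /B !cardsU1 !inE cards1 !xpair_eqE /= andbF.
have z1 : nwt E T 16 = 1 by apply/eqP; rewrite eqn_leq n16.
have /card_gt0P[c] := p16; rewrite inE => /andP[cE /eqP wc].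
have dbl i : Some i \in c -> 1 < mult E T (Some i).
  move=> ic; rewrite ltnNge; apply/negP=> m1.
  have [j [l t]] := recE i m1.
  have m1' : mult E T (Some i) = 1 by apply/eqP; rewrite eqn_leq m1 mult_gt0.
  (* Shortening at a coordinate of [c] removes the only word of weight 16, so [loc] leaves no line
     there and the coordinate must be repeated. *)
  have s16 : nwt (short E (Some i)) T 16 = 0.
    have : nwt (short E (Some i)) T 16 < nwt E T 16.
      apply/proper_card/properP; split.
        by apply/subsetP=> u; rewrite !inE -andbA => /and3P[-> _ ->].
      by exists c; rewrite !inE cE wc eqxx //= ic.
    by rewrite z1 ltnS leqn0 => /eqP.
  have := loc _ m1' s16; rewrite e16 z1 sumpairs_card => /eqP.
  rewrite -[20]/(0 + (18 + 2 * 1)) eqn_add2r cards_eq0 => /eqP/setP/(_ (Some j, Some l)).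
  by rewrite in_set in_set0 /= !inT t.
have : 18 + #|c :\ None| <= eqpairs E T.
  by apply: doubled => -[i|]; rewrite !inE //= => ic; exact: dbl.
rewrite e16 z1; have := cardsD1 None c.
have : 16 <= #|c| by rewrite -wc /wt subset_leq_card // subsetIl.
case: (None \in c); move: (#|c|) (#|c :\ None|); clear; lia.
Qed.

Lemma no_lrc_32_6_15 : no_lrc 6 32 15.
Proof.
move=> I C linC cardC cardI md rec.
pose E := ext_code [set: I] C; pose T := ext_coords [set: I].
have cardT : #|T| = 33 by rewrite /T card_ext_coordsT cardI.
have cardE : #|E| = 2 ^ 6 by rewrite /E card_ext_code.
have linE : linear_code E := ext_linear _ linC.
have mdE : min_dist E T 16 := @ext_min_dist _ _ _ 15 isT md.
have evE : {in E, forall u, ~~ odd (wt T u)} := @ext_even _ _ _.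
have inT x : x \in T := mem_ext_coords x.
(* Deleting a zero column leaves a code of length 32 with an all-one word and distinct columns: no
   coordinate has a copy, and no line is possible. *)
case: (pickP (zerocol E)) => [q zq|nzE].
  have vD : {in E & [set q], forall (u : {set option I}) (i : option I), i \notin u}.
    by move=> u i uE /set1P ->; exact: (zerocolP _ _ zq).
  have mdq := min_dist_vanish vD mdE.
  have cardTq : #|T :\ q| = 32 by move: cardT; rewrite (cardsD1 q) inT => -[].
  have nz := no_zerocol linE cardE cardTq mdq (@no_code_gr 6 31 16 isT).
  have ws : {in E, forall u, u != set0 -> wt (T :\ q) u \in [:: 16; 32]}.
    have nw w h := @no_weight_gr _ _ _ _ _ _ linE cardE cardTq mdq w h.
    move=> u uE uN; move: (nw 18 isT u uE uN) (nw 20 isT u uE uN) (nw 22 isT u uE uN)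
      (nw 24 isT u uE uN) (nw 26 isT u uE uN) (nw 28 isT u uE uN) (nw 30 isT u uE uN)
      (mdq u uE uN) (evE u uE) (wt_le (T :\ q) u).
    rewrite cardTq -(wt_vanish T (D := [set q])); last by move=> i; exact: vD.
    by rewrite !inE; clear; lia.
  have := moments linE cardE cardTq mdq isT nz ws isT.
  rewrite !(big_cons, big_nil) /= => -[m1 m2 m3].
  have [n32 e32] : nwt E (T :\ q) 32 = 1 /\ eqpairs E (T :\ q) = 32.
    by move: m1 m2 m3; move: (nwt _ _ _) (nwt _ _ _) (eqpairs _ _); clear => a b e *; split; lia.
  have /card_gt0P[c] : 0 < nwt E (T :\ q) 32 by rewrite n32.
  rewrite inE => /andP[cE /eqP wc].
  have cT x : x != q -> x \in c.
    move=> xq; have /subsetP : T :\ q \subset c by apply: full_word _; rewrite cardTq.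
    by apply; rewrite in_setD1 xq inT.
  have [i iq] : exists i, Some i != q.
    have /card_gt1P[i [j [_ _ ij]]] : 1 < #|[set: I]| by rewrite cardsT cardI.
    case: (eqVneq (Some i) q) => [e|]; last by exists i.
    by exists j; rewrite -e; apply: contra ij => /eqP[->].
  have nzi x : x != q -> ~~ zerocol E x by move=> xq; apply: nz; rewrite in_setD1 xq inT.
  have nodbl j : Some j != Some i -> ~~ eqc E (Some i) (Some j).
    move=> ji; apply/negP=> e; case: (eqVneq (Some j) q) => [jq|jq].
      by have := nzi _ iq; rewrite (eqc_zerocol e) jq zq.
    have : #|T :\ q| + #|[set Some i]| <= eqpairs E (T :\ q).
      apply: eqpairs_doubled => [|x]; first by rewrite sub1set in_setD1 iq inT.
      move=> /set1P ->; apply/mult_gt1P; first by rewrite in_setD1 iq inT.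
      by exists (Some j); rewrite in_setD1 jq inT.
    by rewrite e32 cardTq cards1.
  have nozero j l : Some j != Some i -> tri E (Some i) (Some j) (Some l) -> Some l != q.
    move=> ji t; apply/eqP=> lq; case/negP: (nodbl j ji); apply/eqcP=> u uE.
    by rewrite (triP _ _ _ _ t) // lq (negbTE (zerocolP _ _ zq u uE)) addbF.
  case: (rec i) => [zi|[j ji e]|[j [l [ji li t]]]].
  - by have := nzi _ iq; rewrite ext_zerocol zi.
  - by have := nodbl j ji; rewrite ext_eqc e.
  rewrite -(ext_tri [set: I]) in t.
  have lq := nozero j l ji t.
  have jq : Some j != q by apply: (nozero l j li); rewrite tri_swap.
  by have := full_word_tri cE (cT _ iq) (cT _ jq) (cT _ lq); rewrite t.
have nz : {in T, forall i, ~~ zerocol E i} by move=> i _; rewrite nzE.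
have ws : {in E, forall u, u != set0 -> wt T u \in [:: 16; 18; 32]}.
  have nw w h := @no_weight_gr _ _ _ _ _ _ linE cardE cardT mdE w h.
  have n20 := no_weight linE cardE cardT mdE (w := 20) no_code_13_5_6.
  have n24 := no_weight linE cardE cardT mdE (w := 24) no_code_9_5_4.
  move=> u uE uN; move: (n20 u uE uN) (n24 u uE uN) (nw 22 isT u uE uN)
    (nw 26 isT u uE uN) (nw 28 isT u uE uN) (nw 30 isT u uE uN)
    (mdE u uE uN) (evE u uE) (wt_le T u).
  by rewrite cardT !inE; clear; lia.
have n32le : nwt E T 32 <= 1 by apply: (nwt_le1 linE mdE); rewrite cardT.
(* The polynomial (w - 16)(w - 18) gives E = 21 + 14 a32, where a32 counts the words of weight 32;
   since E >= 33 and a32 <= 1, it must be 1. *)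
have [n32 e35] : nwt E T 32 = 1 /\ eqpairs E T = 35.
  have := moments linE cardE cardT mdE isT nz ws isT; have := geq_eqpairs E T.
  rewrite cardT !(big_cons, big_nil) /=; move: n32le.
  move: (nwt _ _ _) (nwt _ _ _) (nwt _ _ _) (eqpairs _ _).
  by clear => a b c e h1 h2 [e1 e2 e3]; split; lia.
have /card_gt0P[c] : 0 < nwt E T 32 by rewrite n32.
rewrite inE => /andP[cE /eqP wc].
have [P eP] : exists P, T :\: c = [set P].
  apply/cards1P; have := cardsID c T; rewrite setIC -/(wt T c) wc cardT.
  by move=> /eqP; rewrite -[33]/(32 + 1) eqn_add2l.
have inc x : (x \in c) = (x != P).
  by move/setP/(_ x): eP; rewrite in_set1 in_setD inT andbT => <-; rewrite negbK.
case: P eP inc => [p|] _ inc; last first.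
  have : #|T| + #|Some @: [set: I]| <= eqpairs E T.
    apply: eqpairs_doubled; first by apply/subsetP=> x _; exact: inT.
    move=> _ /imsetP[i _ ->]; apply: (full_word_double cE) => // [j|].
      by rewrite inc.
    by rewrite -(ext_zerocol [set: I]) nzE.
  by rewrite e35 cardT card_Some cardsT cardI.
have nzC i : ~~ zerocol C i by rewrite -(ext_zerocol [set: I]) nzE.
have mult_le2 i : mult E T (Some i) <= 2.
  by have := mult_bound linE cardE mdE (nz (Some i) (inT _)); rewrite cardT -(leq_add2l 31).
have on_line i j : tri C p i j -> mult E T (Some i) = 1.
  rewrite -(ext_tri [set: I]) tri_rot => t.
  by apply: (line_mult1 linE cardE mdE nz _ _ _ _ t); rewrite ?cardT ?inT.
have mult1 i j : mult E T (Some i) = 1 -> eqc C i j -> i = j.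
  move=> m1 e; case: (eqVneq j i) => [->//|ji].
  by have := ext_double ji e; rewrite -/E -/T m1.
(* The word [c] misses only [p], and a line meets it in an even number of points, so every line
   passes through [p]. Thus [F] pairs [i] with its copy or with the third point of its line, and is
   a matching off [p]. *)
pose F i j := ((i != j) && eqc C i j) || tri C p i j.
have Funiq i j l : F i j -> F i l -> j = l.
  case/orP=> [/andP[ij e1]|t1] /orP[/andP[il e2]|t2].
  - apply: contraTeq (mult_le2 i) => jl; rewrite -ltnNge -card_eqc.
    have <- : #|Some i |: (Some j |: [set Some l])| = 3.
      by rewrite !cardsU1 !inE cards1 !negb_or !(inj_eq Some_inj) ij il jl.
    apply/subset_leq_card/subsetP=> x /setU1P[->|/setU1P[->|/set1P->]];
      by rewrite in_set inT /= ?eqc_refl ?ext_eqc.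
  - by rewrite (mult1 _ _ (on_line _ _ t2) e1) eqxx in ij.
  - by rewrite (mult1 _ _ (on_line _ _ t1) e2) eqxx in il.
  have mj : mult E T (Some j) = 1 by apply: (on_line j i); rewrite tri_swap.
  by apply: (mult1 _ _ mj); rewrite (tri_eqc _ t1).
have Fex i : i != p -> exists2 j, j != p & F i j.
  move=> ip; have ic : Some i \in c by rewrite inc.
  case: (rec i) => [zi|[j ji e]|[j [l [ji li t]]]].
  - by have := nzC i; rewrite zi.
  - exists j; last by rewrite /F eq_sym ji e.
    have := eqcP _ _ _ e; rewrite -(ext_eqc [set: I]) in e.
    by have := eqcP _ _ _ e c cE; rewrite ic inc => /esym.
  have := t; rewrite -(ext_tri [set: I]) => /triP /(_ c cE).
  rewrite ic !inc !(inj_eq Some_inj); case: eqVneq => [jp|jp]; case: eqVneq => [lp|lp] // _.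
    by exists l => //; rewrite /F -jp tri_rot t orbT.
  by exists j => //; rewrite /F -lp tri_rot tri_swap t orbT.
suff : ~~ odd (\sum_(i in [set~ p]) \sum_(j in [set~ p]) F i j).
  rewrite (eq_bigr (fun=> 1)) => [|i].
    by rewrite sum1_card cardsC1 cardI.
  rewrite !inE => /Fex[j jp Fij]; rewrite (bigD1 j) ?inE //= Fij big1 // => l /andP[_ lj].
  by apply/eqP; rewrite eqb0; apply: contra lj => /(Funiq _ _ _ Fij) ->.
apply: even_sum_symmetric => [i j|i].
  by rewrite /F eq_sym eqc_sym tri_swap.
by rewrite /F eqxx tri_diag (negbTE (nzC p)).
Qed.

(** * Local parity checks *)

Lemma recoverable_check (I : finType) (C : {set {set I}}) i : recoverable C i ->
  exists h : {set I}, [/\ i \in h, #|h| <= 3 & {in C, forall u, ~~ odd (wt h u)}].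
Proof.
case=> [/zerocolP zi|[j ji /eqcP e]|[j [l [ji li t]]]].
- exists [set i]; rewrite set11 cards1; split=> // u uC.
  by rewrite wtE big_set1 (negbTE (zi u uC)).
- exists (i |: [set j]); rewrite setU11 cardsU1 cards1; split=> // [|u uC].
    by case: (_ \notin _).
  rewrite wtE big_setU1 ?inE 1?eq_sym //= big_set1 e //.
  by case: (j \in u).
case: (eqVneq j l) t => [->|jl].
  rewrite tri_diag => /zerocolP zi.
  exists [set i]; rewrite set11 cards1; split=> // u uC.
  by rewrite wtE big_set1 (negbTE (zi u uC)).
move=> /triP t; exists (i |: (j |: [set l])); rewrite setU11 !cardsU1 cards1; split=> //.
  by do 2!case: (_ \notin _).
move=> u uC; rewrite wtE !big_setU1 ?inE ?negb_or //= ?big_set1; last first.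
  by rewrite !(eq_sym i) ji li.
by rewrite t //; case: (j \in u); case: (l \in u).
Qed.

Section Dual.

Variables (I : finType) (h : I -> {set I}).
Implicit Types (R S : {set I}) (u : {set I}).

Definition annihilated R : {set {set I}} :=
  [set u | [forall r in R, ~~ odd (wt (h r) u)]].

Lemma annihilatedP R u :
  reflect {in R, forall r, ~~ odd (wt (h r) u)} (u \in annihilated R).
Proof. by rewrite inE; exact: forall_inP. Qed.

Lemma annihilated_linear R : linear_code (annihilated R).
Proof.
split=> [|u v /annihilatedP uR /annihilatedP vR]; apply/annihilatedP=> r rR.
  by rewrite wt0.
by rewrite (functional_odd (h r)) (negbTE (uR r rR)) (negbTE (vR r rR)).
Qed.

Lemma annihilatedU1 x R :
  annihilated (x |: R) = ker (annihilated R) (fun u => odd (wt (h x) u)).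
Proof.
apply/setP=> u; rewrite [RHS]inE; apply/annihilatedP/andP.
  by move=> uR; split; [apply/annihilatedP=> r rR|]; apply: uR; rewrite !inE ?eqxx ?rR ?orbT.
by case=> /annihilatedP uR ux r /setU1P[->|/uR].
Qed.

(** The basis is chosen greedily among the given checks, so its members keep weight at most 3; each
    new independent check halves the annihilator. *)
Lemma annihilated_basis S :
  exists2 R : {set I}, annihilated R = annihilated S &
    #|annihilated R| * 2 ^ #|R| = 2 ^ #|I|.
Proof.
have [n] := ubnP #|S|; elim: n S => // n IHn S leSn.
have [->|[x xS]] := set_0Vmem S.
  exists set0 => //; rewrite cards0 muln1 -cardsT -card_powerset.
  by apply: eq_card => u; rewrite !inE subsetT; apply/forall_inP=> r; rewrite inE.
have cS : #|S :\ x| < n by have := cardsD1 x S; rewrite xS; clear -leSn; lia.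
have [R eR cR] := IHn _ cS.
have eS : annihilated S = annihilated (x |: R).
  by rewrite -[S in LHS](setD1K xS) !annihilatedU1 eR.
have [/forall_inP h0|/forall_inPn[u uR /negPn ux]] :=
  boolP [forall u in annihilated R, ~~ odd (wt (h x) u)].
  exists R => //; rewrite eS annihilatedU1; apply/setP=> u; rewrite [RHS]inE.
  by case uR: (u \in _) => //=; rewrite h0.
exists (x |: R); first by rewrite eS.
have xR : x \notin R by apply/negP=> xR; have /annihilatedP/(_ x xR) := uR; rewrite ux.
rewrite cardsU1 xR -cR expnS mulnCA mulnA annihilatedU1.
rewrite -(card_ker (annihilated_linear R)) //; first exact: functional_odd.
by exists u.
Qed.

End Dual.

Section LocalDual.

Variables (n : nat) (I : finType) (C : {set {set I}}).
Hypothesis cardI : #|I| = n.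
Hypothesis (rec : forall i, recoverable C i).

Lemma local_checks : exists (h : I -> {set I}) (R : {set I}),
  [/\ C \subset annihilated h R, #|annihilated h R| * 2 ^ #|R| = 2 ^ n,
      forall r, #|h r| <= 3 & forall i, exists2 r, r \in R & i \in h r].
Proof.
have /fin_all_exists[h hP] i := recoverable_check (rec i).
have [R eR cR] := annihilated_basis h setT.
exists h, R; rewrite cR cardI; split=> // [|r|i]; last 2 first.
- by case: (hP r).
- apply/exists_inP; apply: contraT; rewrite negb_exists_in => /forall_inP ni.
  (* If no basis check contained [i], the word supported at [i] alone would satisfy all checks,
     contrary to the check through [i]. *)
  have : [set i] \in annihilated h R.
    apply/annihilatedP=> r /ni ir; rewrite /wt (_ : _ :&: _ = set0) ?cards0 //.
    by apply/setP=> j; rewrite !inE; case: eqVneq => // ->; rewrite (negbTE ir).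
  rewrite eR => /annihilatedP /(_ i (in_setT _)).
  have [ih _ _] := hP i; rewrite /wt (_ : _ :&: _ = [set i]) ?cards1 //.
  by apply/setIidPl; rewrite sub1set.
by apply/subsetP=> u uC; rewrite eR; apply/annihilatedP=> r _; have [_ _] := hP r; apply.
Qed.

End LocalDual.

Lemma index2_symd (I : finType) (C F : {set {set I}}) u v :
    linear_code C -> linear_code F -> C \subset F -> #|F| = 2 * #|C| ->
  u \in F -> v \in F -> u \notin C -> v \notin C -> symd v u \in C.
Proof.
move=> linC linF CF cF uF vF uC vC.
pose D := [set symd w u | w in C].
have cD : #|D| = #|C| by apply: card_imset; exact: inv_inj (symdK u).
have DF : D \subset F.
  by apply/subsetP=> _ /imsetP[w wC ->]; apply: linF.2 => //; exact: (subsetP CF).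
have CD0 : C :&: D = set0.
  apply/setP=> w; rewrite !inE; apply/andP=> -[wC /imsetP[w' w'C e]].
  case/negP: uC; suff <- : symd w w' = u by apply: linC.2.
  by rewrite e; apply/setP=> i; rewrite !inE; do !case: (_ \in _).
have eF : C :|: D = F.
  apply/eqP; rewrite eqEcard subUset CF DF /= cF cardsU CD0 cards0 cD subn0.
  by rewrite mul2n addnn.
move: vF; rewrite -eF inE (negbTE vC) /= => /imsetP[w wC ->].
by rewrite symdK.
Qed.

Section CheckCount.

Variables (I : finType) (h : I -> {set I}) (R : {set I}).
Hypotheses (h3 : forall r, #|h r| <= 3).
Hypotheses (cov : forall i, exists2 r, r \in R & i \in h r).

Let cw i := \sum_(r in R) (i \in h r).

(** Two such coordinates in one check form a word of weight 2 in the annihilator ([light_pair]),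
    which limits them from above when the code is almost the whole annihilator; [leq_card_light]
    bounds them from below. *)
Definition light := [set i | \sum_(r in R) (i \in h r) == 1].

Let cw_gt0 i : 0 < cw i.
Proof. by have [r rR ir] := cov i; rewrite /cw (bigD1 r) //= ir. Qed.

Let sum_cw : \sum_i cw i <= 3 * #|R|.
Proof.
rewrite /cw exchange_big mulnC -sum_nat_const; apply: leq_sum => r _ /=.
apply: leq_trans (h3 r); rewrite -sum1_card [X in _ <= X]big_mkcond /=.
by apply: leq_sum => i _; case: (i \in h r).
Qed.

Lemma leq_card_checks : #|I| <= 3 * #|R|.
Proof.
apply: leq_trans sum_cw; rewrite -sum1_card; apply: leq_sum => i _.
exact: cw_gt0.
Qed.

Lemma leq_card_light : 2 * #|I| <= 3 * #|R| + #|light|.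
Proof.
apply: leq_trans (leq_add sum_cw (leqnn _)).
rewrite mulnC -sum_nat_const -sum1_card [X in _ + X]big_mkcond -big_split /=.
apply: leq_sum => i _; rewrite inE; have := cw_gt0 i; rewrite -/(cw i).
by case: (cw i) => [|[|m]].
Qed.

Lemma lightP i r s : i \in light -> r \in R -> s \in R -> i \in h r ->
  (i \in h s) = (s == r).
Proof.
rewrite inE => /eqP ci rR sR ir; case: eqVneq => [->//|sr].
move: ci; rewrite (bigD1 r) //= ir => -[/eqP]; rewrite sum_nat_eq0 => /forallP /(_ s).
by rewrite sR sr /= eqb0 => /negbTE.
Qed.

Lemma card_light : #|light| = \sum_(r in R) #|light :&: h r|.
Proof.
transitivity (\sum_(i in light) cw i).
  by rewrite -sum1_card; apply: eq_bigr => i; rewrite inE => /eqP.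
rewrite /cw exchange_big; apply: eq_bigr => r _ /=.
by rewrite setIC -/(wt light (h r)) wtE.
Qed.

Lemma light_pair i j r : r \in R -> i \in light :&: h r -> j \in light :&: h r ->
  symd [set i] [set j] \in annihilated h R.
Proof.
move=> rR /setIP[iL ir] /setIP[jL jr]; apply/annihilatedP=> s sR.
rewrite (functional_odd (h s)).
have w1 x : wt (h s) [set x] = (x \in h s).
  by rewrite /wt; case xs: (x \in h s); [rewrite (setIidPl _) ?cards1 ?sub1set|
    rewrite (_ : _ :&: _ = set0) ?cards0 //; apply/setP=> y; rewrite !inE;
    case: eqVneq => // ->].
by rewrite !w1 (lightP iL rR sR ir) (lightP jL rR sR jr) addbb.
Qed.

End CheckCount.

Lemma check_dim (I : finType) (C F : {set {set I}}) k n s :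
  #|C| = 2 ^ k -> C \subset F -> #|F| * 2 ^ s = 2 ^ n -> k + s <= n.
Proof.
move=> cC CF cF; rewrite -(@leq_exp2l 2) // -cF expnD -cC.
by rewrite leq_pmul2r ?expn_gt0 // subset_leq_card.
Qed.

Lemma no_lrc_8_6_1 : no_lrc 6 8 1.
Proof.
move=> I C linC cardC cardI _ rec.
have [h [R [CF cF h3 cov]]] := local_checks cardI rec.
have := leq_card_checks h3 cov; have := check_dim cardC CF cF; rewrite cardI.
by move: (#|R|); clear; lia.
Qed.

(** Five checks require at least 7 light coordinates, but [C] is then the full annihilator and
    allows one per check. Four checks require at least 10, while in index 2 each check allows two:
    among three, one of the pairwise sums falls into [C]. *)
Lemma no_lrc_11_6_3 : no_lrc 6 11 3.
Proof.
move=> I C linC cardC cardI md rec.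
have [h [R [CF cF h3 cov]]] := local_checks cardI rec.
have := check_dim cardC CF cF.
have := leq_card_light h3 cov; have := leq_card_checks h3 cov; rewrite cardI.
move=> c1 c2 c3; have light2 i j : i != j -> symd [set i] [set j] \notin C.
  move=> ij; apply/negP=> /md; rewrite symd_eq0 (inj_eq set1_inj) => /(_ ij).
  have := wt_symd [set: I] [set i] [set j].
  by rewrite /wt !setIT !cards1; move: (#|_|) (#|_|); clear; lia.
have [s5|s4] : #|R| = 5 \/ #|R| = 4 by move: c1 c3; move: (#|R|); clear; lia.
  have eF : annihilated h R = C.
    apply/esym/eqP; rewrite eqEcard CF cardC -(@leq_pmul2r (2 ^ 5)) // -{1}s5 cF.
    by [].
  have : #|light h R| <= \sum_(r in R) 1.
    rewrite (card_light h R); apply: leq_sum => r rR; rewrite leqNgt.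
    apply/negP=> /card_gt1P[i [j [ir jr ij]]].
    by have := light_pair rR ir jr; rewrite eF (negbTE (light2 i j ij)).
  by rewrite sum1_card; move: c2; rewrite s5; move: (#|_|); clear; lia.
have cF2 : #|annihilated h R| = 2 * #|C|.
  by apply/eqP; rewrite -(@eqn_pmul2r (2 ^ 4)) // -{1}s4 cF cardC.
have : #|light h R| <= \sum_(r in R) 2.
  rewrite (card_light h R); apply: leq_sum => r rR; rewrite leqNgt.
  apply/negP=> /card_gt2P[i [j [l [[ir jr lr] [ij jl li]]]]].
  have := index2_symd linC (annihilated_linear h R) CF cF2 (light_pair rR ir jr)
    (light_pair rR lr ir) (light2 i j ij) (light2 l i li).
  rewrite (_ : symd _ _ = symd [set l] [set j]).
    by apply/negP; rewrite light2 // eq_sym.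
  by apply/setP=> x; rewrite !inE; do !case: (_ == _).
by rewrite sum_nat_const; move: c2; rewrite s4; move: (#|_|); clear; lia.
Qed.

(** * Passing from vector spaces to families of sets *)

Lemma F2_neq0D (x y : 'F_2) : (x + y != 0)%R = (x != 0)%R (+) (y != 0)%R.
Proof. by case: x y => [[|[|//]] ?] [[|[|//]] ?]. Qed.

Lemma F2_eq_neq0 (x y : 'F_2) : (x != 0)%R = (y != 0)%R -> x = y.
Proof. by case: x y => [[|[|//]] ?] [[|[|//]] ?] // _; apply: val_inj. Qed.

Lemma vanish2_recoverable (I : finType) (C : {set {set I}}) (i : I) (S : {set I}) :
    linear_code C -> i \notin S -> #|S| <= 2 ->
    (forall u, u \in C -> {in S, forall j, j \notin u} -> i \notin u) ->
  recoverable C i.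
Proof.
move=> linC iS S2 van; move: S2; rewrite leq_eqVlt ltnS leq_eqVlt ltnS leqn0 cards_eq0.
case/or3P=> [/cards2P[a [b [ab eS]]]|/cards1P[a eS]|/eqP eS]; subst S.
- move: iS; rewrite !inE negb_or => /andP[ia ib].
  have : zerocol (short (short C a) b) i.
    apply/zerocolP=> u; rewrite !inE => /andP[/andP[uC au] bu]; apply: van => // j.
    by rewrite !inE => /orP[] /eqP ->.
  rewrite zerocol_short ?zerocol_short //; last exact: short_linear.
  case/orP=> [/orP[zi|e]|e]; [exact: Or31|by apply: Or32; exists a; rewrite // eq_sym|].
  have [za|nza] := boolP (zerocol C a).
    apply: Or32; exists b; first by rewrite eq_sym.
    apply/eqcP=> u uC; apply: (eqcP _ _ _ e); rewrite inE uC.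
    exact: (zerocolP _ _ za).
  have : 0 < eqc (short C a) i b by rewrite e.
  rewrite eqc_short // addn_gt0 !lt0b => /orP[e'|t].
    by apply: Or32; exists b; rewrite // eq_sym.
  by apply: Or33; exists a, b; rewrite tri_rot t !(eq_sym _ i).
- rewrite inE in iS.
  have : zerocol (short C a) i.
    apply/zerocolP=> u; rewrite !inE => /andP[uC au]; apply: van => // j.
    by rewrite inE => /eqP ->.
  rewrite zerocol_short // => /orP[zi|e]; first exact: Or31.
  by apply: Or32; exists a; rewrite // eq_sym.
by apply: Or31; apply/zerocolP=> u uC; apply: van => // j; rewrite inE.
Qed.

Section Support.

Variables (m n : nat) (le_mn : m <= n).

(** Words of length [m] are padded with zeros to length [n]; a nonexistence result at length [n]
    thereby excludes all shorter lengths too. *)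
Definition supp (u : 'rV['F_2]_m) : {set 'I_n} :=
  [set widen_ord le_mn j | j in [set j | u ord0 j != 0%R]].

Lemma mem_supp u j : (widen_ord le_mn j \in supp u) = (u ord0 j != 0%R).
Proof. by rewrite mem_imset ?inE // => a b /(congr1 val) /= /val_inj. Qed.

Lemma supp_out u (i : 'I_n) : m <= i -> i \notin supp u.
Proof. by move=> mi; apply/imsetP=> -[j _ e]; move: mi; rewrite e leqNgt /= ltn_ord. Qed.

Lemma ord_widenP (i : 'I_n) : (exists j, i = widen_ord le_mn j) \/ m <= i.
Proof.
case: (ltnP i m) => im; [left|by right].
by exists (Ordinal im); apply: val_inj.
Qed.

Lemma supp_inj : injective supp.
Proof.
move=> u v e; apply/rowP=> j; apply: F2_eq_neq0; rewrite -!mem_supp e //.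
Qed.

Lemma suppD u v : supp (u + v)%R = symd (supp u) (supp v).
Proof.
apply/setP=> i; rewrite in_symd; have [[j ->]|mi] := ord_widenP i.
  by rewrite !mem_supp mxE F2_neq0D.
by rewrite !(negbTE (supp_out _ mi)).
Qed.

Lemma supp0 : supp 0%R = set0.
Proof.
apply/setP=> i; rewrite inE; have [[j ->]|mi] := ord_widenP i.
  by rewrite mem_supp mxE eqxx.
exact/negbTE/supp_out.
Qed.

Lemma card_supp u : #|supp u| = hamming_dist u 0%R.
Proof.
rewrite card_imset; last by move=> a b /(congr1 val) /= /val_inj.
by apply: eq_card => j; rewrite !inE mxE.
Qed.

Lemma lrc_set_code k d : lrc_exists 'F_2 m k d 2 ->
  exists C : {set {set 'I_n}}, [/\ linear_code C, #|C| = 2 ^ k,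
    min_dist C [set: 'I_n] d & forall i, recoverable C i].
Proof.
case=> V [[dimV mdV] locV]; exists [set supp u | u in [set u in V]].
have linC : linear_code [set supp u | u in [set u in V]].
  split=> [|_ _ /imsetP[u + ->] /imsetP[v + ->]].
    by rewrite -supp0 imset_f // inE mem0v.
  by rewrite !inE => uV vV; rewrite -suppD imset_f // inE memvD.
split=> //.
- by rewrite card_imset ?cardsE ?card_vspace ?card_Fp ?dimV //; exact: supp_inj.
- move=> _ /imsetP[u + ->]; rewrite inE => uV uN; rewrite /wt setIT card_supp.
  by apply: mdV; rewrite ?mem0v // => u0; rewrite u0 supp0 eqxx in uN.
move=> i; have [[j ->]|mi] := ord_widenP i; last first.
  by apply: Or31; apply/zerocolP=> _ /imsetP[u _ ->]; exact: supp_out.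
have [S [jS S2 van]] := locV j.
apply: (@vanish2_recoverable _ _ _ [set widen_ord le_mn l | l in S]) => //.
- by rewrite mem_imset // => a b /(congr1 val) /= /val_inj.
- exact: leq_trans (leq_imset_card _ _) S2.
move=> _ /imsetP[u + ->]; rewrite inE => uV vu; rewrite mem_supp negbK.
rewrite (van u 0%R uV (mem0v _)) ?mxE // => l lS; rewrite mxE.
by apply/eqP; rewrite -[_ == _]negbK -mem_supp; apply: vu; rewrite imset_f.
Qed.

End Support.

Lemma lrc_lower_bound n k d m : no_lrc k n d -> lrc_exists 'F_2 m k d 2 -> n < m.
Proof.
move=> no ex; rewrite ltnNge; apply/negP=> mn.
have [C [linC cardC md rec]] := lrc_set_code mn ex.
by apply: (no _ C) => //; rewrite card_ord.
Qed.

Lemma no_code_no_lrc n k d : no_code k n d -> no_lrc k n d.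
Proof. by move=> no I C linC cardC cardI md _; apply: (no _ C setT); rewrite ?cardsT. Qed.

Lemma no_lrc_leq n k d d' : d <= d' -> no_lrc k n d -> no_lrc k n d'.
Proof.
move=> dd' no I C linC cardC cardI md; apply: no => // u uC uN.
exact: leq_trans dd' (md u uC uN).
Qed.

Lemma lrc_griesmer k d m : lrc_exists 'F_2 m k d 2 -> griesmer 2 k d <= m.
Proof.
move=> ex; have [C [linC cardC md _]] := lrc_set_code (leqnn m) ex.
have := griesmer_bound linC (eq_leq (esym cardC)) md.
by rewrite cardsT card_ord griesmerE.
Qed.

(** * Constructions *)

Import GRing.Theory.

Definition bits (x : nat) : seq bool := mkseq (fun t => odd (iter t half x)) 6.

Definition points : seq (seq bool) := [seq bits x | x <- iota 1 63].

Definition dotb (a x : seq bool) : bool :=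
  foldr addb false [seq nth false a t && nth false x t | t <- iota 0 6].

Definition xors (x y : seq bool) : seq bool :=
  mkseq (fun t => nth false x t (+) nth false y t) 6.

Definition weights_geq d (s : seq (seq bool)) :=
  all (fun a => d <= count (dotb a) s) points.

Definition local_point (s : seq (seq bool)) x :=
  (1 < count_mem x s) ||
  has (fun y => let z := xors x y in [&& y != x, z != x & z \in s]) s.

Definition good_columns d s := weights_geq d s && all (local_point s) s.

Lemma F2_neq0M (x y : 'F_2) : (x * y != 0)%R = (x != 0)%R && (y != 0)%R.
Proof. by rewrite mulf_eq0 negb_or. Qed.

Lemma F2_nat_neq0 (b : bool) : (b%:R != 0 :> 'F_2)%R = b.
Proof. by case: b. Qed.

Lemma dotbE a x : dotb a x = \big[addb/false]_(t < 6) (nth false a t && nth false x t).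
Proof. by rewrite /dotb foldrE big_map -[iota 0 6]/(index_iota 0 6) big_mkord. Qed.

Lemma dotb_xors a x y : dotb a (xors x y) = dotb a x (+) dotb a y.
Proof.
rewrite !dotbE -big_split; apply: eq_bigr => t _ /=.
by rewrite nth_mkseq //; case: (nth false a t).
Qed.

Lemma hamming_distxx (F : finFieldType) n (u : 'rV[F]_n) : hamming_dist u u = 0.
Proof. by apply: eq_card0 => j; rewrite !inE eqxx. Qed.

Section Generated.

Variable s : seq (seq bool).
Let n := size s.

Definition gen_mx : 'M['F_2]_(6, n) :=
  (\matrix_(t < 6, j < n) (nth false (nth [::] s j) t)%:R)%R.

Definition word_bits (a : 'rV['F_2]_6) : seq bool :=
  mkseq (fun t => a ord0 (inord t) != 0%R) 6.

Lemma gen_mx_neq0 a (j : 'I_n) :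
  ((a *m gen_mx) ord0 j != 0)%R = dotb (word_bits a) (nth [::] s j).
Proof.
rewrite mxE dotbE (big_morph (fun x : 'F_2 => x != 0%R) F2_neq0D (erefl _)).
apply: eq_bigr => t _; rewrite F2_neq0M mxE F2_nat_neq0 nth_mkseq //.
by rewrite inord_val.
Qed.

Lemma word_bits_points a : a != 0%R -> word_bits a \in points.
Proof.
move=> aN; have [t at_] : exists t, a ord0 t != 0%R.
  apply/existsP; apply: contraR aN; rewrite negb_exists => /forallP a0.
  by apply/eqP/rowP=> t; rewrite mxE; apply/eqP; rewrite -[_ == _]negbK a0.
have : nth false (word_bits a) t by rewrite nth_mkseq // inord_val.
rewrite /word_bits /mkseq /=.
by do 6!case: (_ != 0)%R; case: t {at_} => [[|[|[|[|[|[|//]]]]]] ?].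
Qed.

Lemma card_count (P : pred (seq bool)) :
  #|[set j : 'I_n | P (nth [::] s j)]| = count P s.
Proof.
rewrite -sum1_count (big_nth [::]) big_mkord -sum1_card.
by apply: eq_bigl => j; rewrite inE.
Qed.

Lemma good_columns_lrc d : 0 < d -> good_columns d s -> lrc_exists 'F_2 n 6 d 2.
Proof.
move=> d0 /andP[/allP wd /allP loc].
pose f := linfun (mulmxr gen_mx : 'rV['F_2]_6 -> 'rV['F_2]_n).
have fE a : f a = (a *m gen_mx)%R by rewrite lfunE.
have wtf a b : a != b -> d <= hamming_dist (a *m gen_mx)%R (b *m gen_mx)%R.
  move=> ab; have := wd _ (word_bits_points (a := (a - b)%R) _).
  rewrite subr_eq0 => /(_ ab); rewrite -card_count => /leq_trans; apply.
  apply: subset_leq_card; apply/subsetP=> j; rewrite !inE -gen_mx_neq0 mulmxBl.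
  by rewrite !mxE subr_eq0.
have finj : lker f == 0%VS.
  apply/lker0P=> a b; rewrite !fE => e; apply/eqP; apply: contraT => /wtf.
  by rewrite e hamming_distxx leqNgt d0.
exists (limg f); split; first split.
- by rewrite limg_dim_eq ?(eqP finj) ?capv0 // dimvf /dim /= mul1n.
- move=> _ _ /memv_imgP[a _ ->] /memv_imgP[b _ ->]; rewrite !fE => ab.
  by apply: wtf; apply: contra_notN ab => /eqP ->.
move=> j; set x := nth [::] s j.
have := loc x (mem_nth _ (ltn_ord j)).
case/orP=> [|/hasP[y ys /and3P[yx zx zs]]].
  rewrite -(card_count (pred1 x)) => /card_gt1P[l [l' []]].
  rewrite !inE => /eqP lx /eqP l'x ll'.
  have [k kj kx] : exists2 k : 'I_n, k != j & nth [::] s k = x.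
    by case: (eqVneq l j) ll' => [<-|lj _]; [exists l'; rewrite // eq_sym|exists l].
  exists [set k]; rewrite inE eq_sym cards1; split=> //.
  move=> _ _ /memv_imgP[a _ ->] /memv_imgP[b _ ->]; rewrite !fE => e.
  have {e} := e k (set11 k) => e; apply: F2_eq_neq0.
  by rewrite !gen_mx_neq0 -/x -kx -!gen_mx_neq0 e.
set z := xors x y in zx zs.
have [l ly] : exists l : 'I_n, nth [::] s l = y.
  have ly := ys; rewrite -index_mem in ly.
  by exists (Ordinal ly); rewrite /= nth_index.
have [k kz] : exists k : 'I_n, nth [::] s k = z.
  have kz := zs; rewrite -index_mem in kz.
  by exists (Ordinal kz); rewrite /= nth_index.
exists [set l; k]; split.
- rewrite !inE negb_or; apply/andP; split.
    by apply: contra yx => /eqP jl; rewrite -ly -jl.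
  by apply: contra zx => /eqP jk; rewrite -kz -jk.
- by rewrite cards2; case: (_ != _).
move=> _ _ /memv_imgP[a _ ->] /memv_imgP[b _ ->]; rewrite !fE => e.
have [el ek] : (a *m gen_mx)%R ord0 l = (b *m gen_mx)%R ord0 l
    /\ (a *m gen_mx)%R ord0 k = (b *m gen_mx)%R ord0 k.
  by split; apply: e; rewrite !inE eqxx ?orbT.
have xE c : dotb c x = dotb c y (+) dotb c z.
  by rewrite /z dotb_xors addbC -addbA addbb addbF.
apply: F2_eq_neq0; rewrite !gen_mx_neq0 -/x !xE -ly -kz.
by rewrite -!gen_mx_neq0 el ek.
Qed.

End Generated.

Lemma local_point_cat s1 s2 x :
  local_point s1 x || local_point s2 x -> local_point (s1 ++ s2) x.
Proof.
rewrite /local_point has_cat count_cat => /orP[]/orP[c|/hasP[y ys /and3P[yx zx zs]]];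
  apply/orP.
- by left; apply: leq_trans c (leq_addr _ _).
- right; apply/orP; left; apply/hasP; exists y => //.
  by rewrite /= yx zx mem_cat zs.
- by left; apply: leq_trans c (leq_addl _ _).
right; apply/orP; right; apply/hasP; exists y => //.
by rewrite /= yx zx mem_cat zs orbT.
Qed.

Lemma good_points : good_columns 32 points.
Proof. by vm_compute. Qed.

Lemma good_columns_cat d e s1 s2 :
  good_columns d s1 -> good_columns e s2 -> good_columns (d + e) (s1 ++ s2).
Proof.
move=> /andP[/allP w1 /allP l1] /andP[/allP w2 /allP l2]; apply/andP; split.
  by apply/allP=> a aP; rewrite count_cat leq_add ?w1 ?w2.
apply/allP=> x; rewrite mem_cat => /orP[/l1|/l2] lx; apply: local_point_cat.
  by rewrite lx.
by rewrite lx orbT.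
Qed.

Definition span (g : seq nat) : seq (seq bool) :=
  foldr (fun v s => s ++ [seq xors (bits v) w | w <- s]) [:: bits 0] g.

(** Generators of subspaces of dimensions 1 to 5, not nested: they are placed so that no point lies
    in more of the chosen ones than there are copies of the space. *)
Definition flag : seq (seq nat) :=
  [:: [:: 10]; [:: 17; 2]; [:: 6; 1; 40]; [:: 4; 8; 16; 32]; [:: 1; 2; 4; 8; 16]].

(** The Solomon-Stiffler and Belov construction. Bit [i] of [32 * t - d] removes a subspace of
    dimension [i + 1], at the price of 2^i in distance and 2^(i+1) - 1 in length, exactly the drop
    of the Griesmer sum. A point removed too often would be masked by truncated subtraction; the
    length test in [belov_good] detects this. *)
Definition belov d : seq (seq bool) :=
  let t := if d <= 32 then 1 else 2 in
  let Us := mask (mkseq (fun i => odd (iter i half (32 * t - d))) 5) (map span flag) in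
  flatten [seq nseq (t - count (fun U => x \in U) Us) x | x <- points].

(** The distances 21 to 48, and 51 and 52: these two cannot be reached by adding 32, since 19 and 20
    miss the Griesmer bound. *)
Definition belov_range := iota 21 28 ++ [:: 51; 52].

Lemma belov_good :
  all (fun d => (size (belov d) == gr 6 d) && good_columns d (belov d)) belov_range.
Proof. by vm_compute. Qed.

(* Found by simulated annealing. The lists of lengths 23, 26, 31, 38 and 42 are
   arranged so that deleting the first column keeps locality, which gives the
   codes for odd [d]. *)
Definition columns9 := map bits
  [:: 3; 5; 15; 16; 21; 36; 43; 57; 58].

Definition columns12 := map bits
  [:: 13; 19; 20; 25; 26; 27; 32; 43; 46; 49; 59; 61].

Definition columns15 := map bits
  [:: 4; 5; 6; 10; 16; 18; 24; 25; 31; 32; 37; 41; 45; 46; 62].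

Definition columns18 := map bits
  [:: 5; 8; 11; 12; 20; 26; 27; 28; 29; 30; 36; 46; 49; 51; 55; 60; 61; 62].

Definition columns23 := map bits
  [:: 2; 1; 9; 10; 11; 12; 13; 18; 19; 20; 23; 26; 28; 33; 39; 40; 41; 45;
      46; 49; 56; 60; 63].

Definition columns26 := map bits
  [:: 3; 4; 6; 13; 14; 15; 17; 19; 22; 25; 33; 36; 38; 40; 42; 45; 46; 47;
      50; 51; 52; 53; 54; 58; 62; 63].

Definition columns31 := map bits
  [:: 3; 8; 10; 15; 16; 17; 18; 19; 20; 21; 22; 23; 26; 27; 30; 35; 37; 38;
      39; 40; 41; 42; 43; 44; 45; 46; 49; 51; 52; 53; 58].

Definition columns33 := map bits
  [:: 1; 3; 4; 6; 7; 9; 11; 12; 14; 16; 18; 21; 23; 24; 26; 29; 31; 32; 34;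
      37; 39; 40; 42; 45; 47; 49; 51; 52; 54; 57; 59; 59; 62].

Definition columns38 := map bits
  [:: 2; 3; 4; 5; 8; 9; 14; 15; 18; 19; 20; 21; 23; 24; 25; 26; 27; 29; 30;
      31; 32; 33; 35; 38; 39; 40; 42; 43; 44; 45; 48; 49; 54; 55; 58; 59;
      60; 61].

Definition columns42 := map bits
  [:: 2; 3; 6; 8; 9; 12; 13; 16; 17; 18; 19; 20; 21; 22; 23; 24; 26; 27; 28;
      29; 30; 31; 33; 36; 37; 42; 43; 46; 47; 48; 49; 50; 51; 52; 53; 54;
      55; 56; 58; 61; 62; 63].

Lemma good_columns17 : good_columns 17 (behead columns38).
Proof. by vm_compute. Qed.

Lemma good_columns18 : good_columns 18 columns38.
Proof. by vm_compute. Qed.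

Lemma gr6D32 d : gr 6 (d + 32) = gr 6 d + 63.
Proof. by rewrite /=; lia. Qed.

Lemma griesmer_columns d : 21 <= d \/ d = 17 \/ d = 18 ->
  exists2 s, size s = gr 6 d & good_columns d s.
Proof.
elim/ltn_ind: d => d IHd [d21|[->|->]]; last 2 first.
- by exists (behead columns38); [|exact: good_columns17].
- by exists columns38; [|exact: good_columns18].
have [dr|dr] := boolP (d \in belov_range).
  by have /andP[/eqP] := allP belov_good d dr; exists (belov d).
have [d49 dsub] : 49 <= d /\ (21 <= d - 32 \/ d - 32 = 17 \/ d - 32 = 18).
  by move: dr; rewrite mem_cat mem_iota !inE; lia.
have [|s ss gs] := IHd (d - 32) _ dsub; first lia.
exists (s ++ points); first by rewrite size_cat ss -gr6D32 subnK //; lia.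
by rewrite -[d](@subnK 32); [exact: good_columns_cat good_points|lia].
Qed.

(** Allowing [d0 <= d] lets the lower bound for an odd distance serve the next even one where both
    have the same optimal length. *)
Lemma is_min_length_columns s n d0 d : 0 < d -> d0 <= d -> size s = n.+1 ->
  good_columns d s -> no_lrc 6 n d0 -> is_min_length 'F_2 6 d 2 n.+1.
Proof.
move=> dgt0 d0d ss gs no; split; first by rewrite -ss; exact: good_columns_lrc.
by move=> m; apply: lrc_lower_bound; exact: no_lrc_leq no.
Qed.

Theorem theorem33 :
  (forall d : nat, 21 <= d \/ d = 17 \/ d = 18 ->
     is_min_length 'F_2 6 d 2 (griesmer 2 6 d)) /\
  (is_min_length 'F_2 6 1 2 9 /\
   is_min_length 'F_2 6 2 2 9 /\
   is_min_length 'F_2 6 3 2 12 /\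
   is_min_length 'F_2 6 4 2 12 /\
   is_min_length 'F_2 6 5 2 15 /\
   is_min_length 'F_2 6 6 2 15 /\
   is_min_length 'F_2 6 7 2 18 /\
   is_min_length 'F_2 6 8 2 18 /\
   is_min_length 'F_2 6 9 2 22 /\
   is_min_length 'F_2 6 10 2 23 /\
   is_min_length 'F_2 6 11 2 25 /\
   is_min_length 'F_2 6 12 2 26 /\
   is_min_length 'F_2 6 13 2 30 /\
   is_min_length 'F_2 6 14 2 31 /\
   is_min_length 'F_2 6 15 2 33 /\
   is_min_length 'F_2 6 16 2 33 /\
   is_min_length 'F_2 6 19 2 41 /\
   is_min_length 'F_2 6 20 2 42).
Proof.
split=> [d dr|].
  split; last by move=> m; exact: lrc_griesmer.
  have [s ss gs] := griesmer_columns dr.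
  rewrite griesmerE -ss; apply: good_columns_lrc gs.
  by case: dr => [|[->|->]] //; exact: leq_trans.
have no21 : no_lrc 6 21 9.
  exact/no_code_no_lrc/no_even_no_code_punctured/no_code_even/no_code_22_6_10.
have no24 : no_lrc 6 24 11.
  exact/no_code_no_lrc/no_even_no_code_punctured/no_code_even/no_code_25_6_12.
have no40 : no_lrc 6 40 19.
  exact/no_code_no_lrc/no_even_no_code_punctured/no_even_code_41_6_20.
split; first by apply: (@is_min_length_columns columns9 8 1 1 isT isT erefl _
    no_lrc_8_6_1); vm_compute.
split; first by apply: (@is_min_length_columns columns9 8 1 2 isT isT erefl _
    no_lrc_8_6_1); vm_compute.
split; first by apply: (@is_min_length_columns columns12 11 3 3 isT isT erefl _
    no_lrc_11_6_3); vm_compute.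
split; first by apply: (@is_min_length_columns columns12 11 3 4 isT isT erefl _
    no_lrc_11_6_3); vm_compute.
split; first by apply: (@is_min_length_columns columns15 14 5 5 isT isT erefl _
    no_lrc_14_6_5); vm_compute.
split; first by apply: (@is_min_length_columns columns15 14 5 6 isT isT erefl _
    no_lrc_14_6_5); vm_compute.
split; first by apply: (@is_min_length_columns columns18 17 7 7 isT isT erefl _
    no_lrc_17_6_7); vm_compute.
split; first by apply: (@is_min_length_columns columns18 17 7 8 isT isT erefl _
    no_lrc_17_6_7); vm_compute.
split; first by apply: (@is_min_length_columns (behead columns23) 21 9 9 isT isT erefl _
    no21); vm_compute.
split; first by apply: (@is_min_length_columns columns23 22 10 10 isT isT erefl _
    (no_code_no_lrc no_code_22_6_10)); vm_compute.
split; first by apply: (@is_min_length_columns (behead columns26) 24 11 11 isT isT erefl _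
    no24); vm_compute.
split; first by apply: (@is_min_length_columns columns26 25 12 12 isT isT erefl _
    (no_code_no_lrc no_code_25_6_12)); vm_compute.
split; first by apply: (@is_min_length_columns (behead columns31) 29 13 13 isT isT erefl _
    no_lrc_29_6_13); vm_compute.
split; first by apply: (@is_min_length_columns columns31 30 14 14 isT isT erefl _
    no_lrc_30_6_14); vm_compute.
split; first by apply: (@is_min_length_columns columns33 32 15 15 isT isT erefl _
    no_lrc_32_6_15); vm_compute.
split; first by apply: (@is_min_length_columns columns33 32 15 16 isT isT erefl _
    no_lrc_32_6_15); vm_compute.
split; first by apply: (@is_min_length_columns (behead columns42) 40 19 19 isT isT erefl _
    no40); vm_compute.
by apply: (@is_min_length_columns columns42 41 20 20 isT isT erefl _
    (no_code_no_lrc no_code_41_6_20)); vm_compute.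
Qed.
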